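(* Let $m,d\in\mathbb{N}$ and let $\phi:[0,1]^{m}\times[0,1]\to\mathbb{R}^{d}$ be a family of rationally non-degenerate analytic curves of order $\kappa$, where $2\leq\kappa\leq\infty$. Let $\{\rho_{n}\}_{n=1}^{\infty}\subseteq\mathbb{R}$ with $\rho_{n}\to\infty$, and assume that \begin{itemize} \item if $\kappa<\infty$, then $\rho_{n}=o(n^{\kappa})$; \item if $\kappa=\infty$, then there exists $l\in\mathbb{N}$ such that $\rho_{n}=o(n^{l})$. \end{itemize} Let $\{\mathbf{x}_{n}\}_{n=1}^{\infty}\subseteq[0,1]^{m}$ be arbitrary, and put $\gamma_{n}(t)=\rho_{n}\phi(\mathbf{x}_{n},t)$ for $t\in[0,1]$. Then the sequence of probability measures \[ \mu_{n}=\frac{1}{n}\sum_{k=1}^{n}\delta_{\pi(\gamma_{n}(k/n))} \] on $\mathbb{T}^{d}=\mathbb{R}^{d}/\mathbb{Z}^{d}$ equidistributes.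
   Context: $\pi:\mathbb{R}^{d}\to\mathbb{R}^{d}/\mathbb{Z}^{d}$ is the natural projection. A sequence of probability measures $\mu_n$ on $\mathbb{T}^d$ equidistributes if $\lim_{n\to\infty}\mu_{n}(f)=\int_{\mathbb{T}^{d}}f\,d\mathbf{x}$ for all continuous $f$ on $\mathbb{T}^{d}$, where $d\mathbf{x}$ is normalized Haar measure. ''Analytic'' means real analytic (on a neighbourhood of the closed domain). For a smooth curve $\gamma:[0,1]\to\mathbb{R}^{d}$ and $j\in\mathbb{N}$, let $\gamma^{(j)}=(\gamma_{1}^{(j)},\dots,\gamma_{d}^{(j)})$ be the componentwise $j$-th derivative. $\gamma$ is rationally non-degenerate (RND) of order $\kappa\in\mathbb{N}\cup\{\infty\}$ if $\kappa=\sup\{j\in\mathbb{N}: \text{for every }\mathbf{h}\in\mathbb{Z}^{d}\setminus\{\mathbf{0}\},\ t\mapsto\langle\mathbf{h},\gamma^{(j)}(t)\rangle\text{ is not identically zero}\}$. A family $\phi:[0,1]^{m}\times[0,1]\to\mathbb{R}^{d}$ of smooth curves is RND of order $\kappa$ if $\kappa=\inf\{\text{order of }\phi(\mathbf{x},\cdot):\mathbf{x}\in[0,1]^{m}\}$. *)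

(* Defs.v *)
From Stdlib Require Import Reals ZArith.
From Coquelicot Require Import Coquelicot.
From mathcomp Require Import all_boot all_order all_algebra.
From mathcomp Require Import Rstruct.

Set Implicit Arguments.
Unset Strict Implicit.
Unset Printing Implicit Defensive.

Local Open Scope R_scope.

Definition rsum (I : finType) (F : I -> R) : R := (\sum_(i : I) F i)%R.
Definition rprod (I : finType) (F : I -> R) : R := (\prod_(i : I) F i)%R.
Definition rsum_nat (a b : nat) (F : nat -> R) : R := (\sum_(a <= k < b) F k)%R.

Definition in_cube (n : nat) (x : 'I_n -> R) : Prop :=
  forall i : 'I_n, 0 <= x i <= 1.

(* Real analyticity of F : R^m x R -> R at the point (p, s):
   F is given, on a neighbourhood of (p,s), by an absolutely convergent
   power series  sum_{a in N^m, b in N} c a b (x-p)^a (t-s)^b.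
   Partial sums are taken over the boxes {a_j <= K, b <= K}; absolute
   convergence makes the sum independent of the exhaustion.            *)
Definition ps_partial (m : nat) (c : ('I_m -> nat) -> nat -> R)
  (p : 'I_m -> R) (s : R) (x : 'I_m -> R) (t : R) (K : nat) : R :=
  rsum (fun a : {ffun 'I_m -> 'I_K.+1} =>
    rsum (fun b : 'I_K.+1 =>
      c (fun j => nat_of_ord (a j)) b *
      rprod (fun j : 'I_m => (x j - p j) ^ (a j)) * (t - s) ^ b)).

Definition ps_abs_partial (m : nat) (c : ('I_m -> nat) -> nat -> R)
  (p : 'I_m -> R) (s : R) (x : 'I_m -> R) (t : R) (K : nat) : R :=
  rsum (fun a : {ffun 'I_m -> 'I_K.+1} =>
    rsum (fun b : 'I_K.+1 =>
      Rabs (c (fun j => nat_of_ord (a j)) b) *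
      rprod (fun j : 'I_m => Rabs (x j - p j) ^ (a j)) * Rabs (t - s) ^ b)).

Definition analytic_at (m : nat) (F : ('I_m -> R) -> R -> R)
  (p : 'I_m -> R) (s : R) : Prop :=
  exists r : R, 0 < r /\
  exists c : ('I_m -> nat) -> nat -> R,
    forall (x : 'I_m -> R) (t : R),
      (forall j, Rabs (x j - p j) < r) -> Rabs (t - s) < r ->
      (exists M : R, forall K, ps_abs_partial c p s x t K <= M) /\
      is_lim_seq (fun K => ps_partial c p s x t K) (F x t).

(* phi : [0,1]^m x [0,1] -> R^d is (real) analytic, i.e. analytic on a
   neighbourhood of the closed domain: every component is analytic at
   every point of [0,1]^m x [0,1]. *)
Definition family_analytic (m d : nat)
  (phi : ('I_m -> R) -> R -> ('I_d -> R)) : Prop :=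
  forall (i : 'I_d) (p : 'I_m -> R) (s : R),
    in_cube p -> 0 <= s <= 1 -> analytic_at (fun x t => phi x t i) p s.

(* N u {oo}: None stands for infinity. *)
Definition enat := option nat.
Definition enat_le (a b : enat) : Prop :=
  match a, b with
  | _, None => True
  | None, Some _ => False
  | Some x, Some y => (x <= y)%nat
  end.

Definition hdot_deriv (d : nat) (g : R -> 'I_d -> R) (h : 'I_d -> Z)
  (j : nat) (t : R) : R :=
  rsum (fun i : 'I_d => IZR (h i) * Derive_n (fun u => g u i) j t).

Definition rnd_index (d : nat) (g : R -> 'I_d -> R) (j : nat) : Prop :=
  (1 <= j)%nat /\
  forall h : 'I_d -> Z, (exists i, h i <> Z0) ->
    exists t, 0 <= t <= 1 /\ hdot_deriv g h j t <> 0.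

Definition curve_rnd_order (d : nat) (g : R -> 'I_d -> R) (k : enat) : Prop :=
  (forall j, rnd_index g j -> enat_le (Some j) k) /\
  (forall u : enat, (forall j, rnd_index g j -> enat_le (Some j) u) ->
     enat_le k u).

Definition family_rnd_order (m d : nat)
  (phi : ('I_m -> R) -> R -> ('I_d -> R)) (k : enat) : Prop :=
  exists ord : ('I_m -> R) -> enat,
    (forall x, in_cube x -> curve_rnd_order (phi x) (ord x)) /\
    (forall x, in_cube x -> enat_le k (ord x)) /\
    (forall u : enat, (forall x, in_cube x -> enat_le u (ord x)) ->
       enat_le u k).

(* Continuous functions on T^d = R^d / Z^d, represented as continuous
   Z^d-periodic functions on R^d. *)
Definition vec_continuous (d : nat) (f : ('I_d -> R) -> R) : Prop :=
  forall (v : 'I_d -> R) (eps : R), 0 < eps ->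
    exists delta, 0 < delta /\
      forall w : 'I_d -> R, (forall i, Rabs (w i - v i) < delta) ->
        Rabs (f w - f v) < eps.

Definition Zd_periodic (d : nat) (f : ('I_d -> R) -> R) : Prop :=
  forall (v : 'I_d -> R) (z : 'I_d -> Z), f (fun i => v i + IZR (z i)) = f v.

Definition torus_continuous (d : nat) (f : ('I_d -> R) -> R) : Prop :=
  vec_continuous f /\ Zd_periodic f.

(* Integral against normalized Haar measure on T^d, for continuous f:
   the (iterated Riemann) integral of the periodic lift over [0,1]^d. *)
Fixpoint iter_int (n : nat) (g : (nat -> R) -> R) : R :=
  match n with
  | O => g (fun _ => 0)
  | S n' => RInt (fun s => iter_int n'
               (fun v => g (fun k => if Nat.eqb k n' then s else v k))) 0 1
  end.

Definition haar_int (d : nat) (f : ('I_d -> R) -> R) : R :=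
  iter_int d (fun v => f (fun i : 'I_d => v (nat_of_ord i))).

(* Main.v *)
(** By Weyl's criterion the theorem reduces to exponential sums with phase
    [rho n * F (x, k / n)], where [F = <h, phi>] and the [q]-th [t]-derivative
    of [F x] is not identically zero for any [x], with [rho n = o(n^q)].

    By analyticity that derivative has isolated zeros on [[0, 1]]; away from
    them it is bounded below, uniformly for [x] in a neighbourhood of a given
    parameter, and compactness of the cube makes everything uniform in [x].
    On such pieces the phase [f k] has [q]-th differences comparable to
    [lam = rho n / n^q].  Van der Corput's inequality with shifts by multiples
    of a suitably chosen step turns this into the same problem of order
    [q - 1], and order [1] is the Kusmin-Landau inequality.

    The integral over the torus is reached one coordinate at a time, with
    Fejer's kernel and the test functions [1 - cos] of Korovkin's theorem. *)

Require Import Defs.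
From Stdlib Require Import Reals ZArith Lra Lia Classical ClassicalEpsilon FunctionalExtensionality.
From Coquelicot Require Import Coquelicot.
From mathcomp Require Import all_boot all_algebra Rstruct zify.

Local Open Scope R_scope.

(** * Finite sums *)

(** Two scale conditions drive the induction on the order: the size [lam] of the [j]-th differences
    is small, and [lam * n ^ j] is large. For the original phase they say that [rho n = o(n ^ q)]
    and that [rho n] tends to infinity. A shift by [p] multiplies the differences by [p] and lowers
    the order by one, so a bounded shift of a phase of order [j + 1] may leave [p * lam * n ^ j] too
    small. The step must therefore be at least a constant over [lam * n ^ j]; it is still short
    compared with [n], precisely because [lam * n ^ (j + 1)] is large.

    The parameters [xs n] are arbitrary, so no threshold may depend on them: each is found near one
    parameter and made common by a Lebesgue number.

    An infinite order is reduced to a finite one, since a derivative that is not identically zero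
    forces the same for the lower ones.

    Complex exponentials are avoided throughout: a free phase [th] lets a cosine stand for both real
    and imaginary part. *)

Fixpoint nsum (n : nat) (f : nat -> R) : R :=
  match n with
  | O => 0
  | S n' => nsum n' f + f n'
  end.

Lemma nsum_ext n f g :
  (forall k, (k < n)%N -> f k = g k) -> nsum n f = nsum n g.
Proof.
elim: n => [//|n IH] H /=.
by rewrite IH ?H // => k Hk; apply: H; lia.
Qed.

Lemma nsum_le n f g :
  (forall k, (k < n)%N -> f k <= g k) -> nsum n f <= nsum n g.
Proof.
elim: n => [|n IH] H /=; first lra.
apply: Rplus_le_compat; last by apply: H; lia.
by apply: IH => k Hk; apply: H; lia.
Qed.

Lemma nsum_plus n f g : nsum n (fun k => f k + g k) = nsum n f + nsum n g.
Proof. by elim: n => [|n IH] /=; [lra | rewrite IH; lra]. Qed.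

Lemma nsum_scal n c f : nsum n (fun k => c * f k) = c * nsum n f.
Proof. by elim: n => [|n IH] /=; [lra | rewrite IH; lra]. Qed.

Lemma nsum_minus n f g : nsum n (fun k => f k - g k) = nsum n f - nsum n g.
Proof. by elim: n => [|n IH] /=; [lra | rewrite IH; lra]. Qed.

Lemma nsum_const n c : nsum n (fun _ => c) = INR n * c.
Proof. by elim: n => [|n IH]; [simpl; lra | rewrite S_INR /= IH; lra]. Qed.

Lemma nsum_abs n f : Rabs (nsum n f) <= nsum n (fun k => Rabs (f k)).
Proof.
elim: n => [|n IH] /=; first by rewrite Rabs_R0; lra.
by move: (Rabs_triang (nsum n f) (f n)); lra.
Qed.

Lemma nsum_abs_le n f c :
  (forall k, (k < n)%N -> Rabs (f k) <= c) -> Rabs (nsum n f) <= INR n * c.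
Proof.
move=> H; apply: Rle_trans (nsum_abs _ _) _.
by rewrite -nsum_const; apply: nsum_le.
Qed.

Lemma nsum_exch n m (f : nat -> nat -> R) :
  nsum n (fun i => nsum m (fun j => f i j)) =
  nsum m (fun j => nsum n (fun i => f i j)).
Proof.
elim: n => [|n IH] /=; last by rewrite IH nsum_plus.
by rewrite (nsum_const m 0); lra.
Qed.

Lemma nsum_add n m f :
  nsum (n + m)%N f = nsum n f + nsum m (fun k => f (n + k)%N).
Proof.
elim: m => [|m IH]; first by rewrite addn0 /=; lra.
by rewrite addnS /= IH; lra.
Qed.

Lemma nsum_delta n i c :
  (i < n)%N -> nsum n (fun j => if i == j then c else 0) = c.
Proof.
elim: n => [//|n IH] Hi /=; case: eqP => [->|ne].
  rewrite (@nsum_ext n _ (fun _ => 0)); first by rewrite nsum_const; lra.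
  by move=> k Hk; case: eqP => // E; lia.
by rewrite IH; [lra | lia].
Qed.

Lemma nsum_telescope n f : nsum n (fun k => f k.+1 - f k) = f n - f O.
Proof. by elim: n => [|n IH] /=; [lra | rewrite IH; lra]. Qed.

(** The square of the modulus of the sum of [exp (i a_k)], in real form. It opens the square in van
    der Corput's inequality and gives the positivity of Fejer's kernel. *)
Lemma cos_sum_sqr n (a : nat -> R) :
  nsum n (fun i => nsum n (fun j => cos (a i - a j))) =
  (nsum n (fun i => cos (a i))) ^ 2 + (nsum n (fun i => sin (a i))) ^ 2.
Proof.
set C := nsum n (fun i => cos (a i)); set S := nsum n (fun i => sin (a i)).
transitivity (nsum n (fun i => C * cos (a i) + S * sin (a i))).
  apply: nsum_ext => i _.
  transitivity (nsum n (fun j => cos (a i) * cos (a j) + sin (a i) * sin (a j))).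
    by apply: nsum_ext => j _; rewrite cos_minus.
  by rewrite nsum_plus !nsum_scal -/C -/S; ring.
by rewrite nsum_plus !nsum_scal -/C -/S; ring.
Qed.

(** Induction: passing from [n] to [n.+1], the right side minus the left side grows by exactly the
    sum of the [(f k - f n) ^ 2]. *)
Lemma nsum_cauchy_schwarz n f : (nsum n f) ^ 2 <= INR n * nsum n (fun k => f k ^ 2).
Proof.
elim: n => [|n IH]; first by simpl; lra.
rewrite S_INR /=.
have HN := pos_INR n.
have H0 : 0 <= nsum n (fun k => (f k - f n) ^ 2).
  have -> : 0 = nsum n (fun _ => 0) by rewrite nsum_const; lra.
  by apply: nsum_le => k _; apply: pow2_ge_0.
have E : nsum n (fun k => (f k - f n) ^ 2) =
   nsum n (fun k => f k ^ 2) - 2 * f n * nsum n f + INR n * f n ^ 2.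
  transitivity (nsum n (fun k => f k ^ 2 - 2 * f n * f k + f n ^ 2)).
    by apply: nsum_ext => k _; ring.
  by rewrite nsum_plus nsum_minus nsum_const nsum_scal.
simpl in *; nra.
Qed.

Lemma nsum_shift_dist n h f :
  (forall k, Rabs (f k) <= 1) ->
  Rabs (nsum n (fun k => f (h + k)%N) - nsum n f) <= 2 * INR h.
Proof.
move=> Hf.
have E : nsum n (fun k => f (h + k)%N) - nsum n f =
         nsum h (fun k => f (n + k)%N) - nsum h f.
  by have := nsum_add n h f; rewrite addnC nsum_add; lra.
rewrite E.
have H1 : Rabs (nsum h (fun k => f (n + k)%N)) <= INR h * 1 by apply: nsum_abs_le.
have H2 : Rabs (nsum h f) <= INR h * 1 by apply: nsum_abs_le.
by move: H1 H2; rewrite /Rabs; repeat case: Rcase_abs => ?; lra.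
Qed.

Lemma nsum_trunc_dist n h f :
  (forall k, Rabs (f k) <= 1) ->
  Rabs (nsum n f - nsum (n - h)%N f) <= INR h.
Proof.
move=> Hf.
have -> : n = ((n - h) + minn n h)%N by lia.
rewrite nsum_add.
have -> : (n - h + minn n h - h = n - h)%N by lia.
set a := nsum _ _; set b := nsum _ _.
have -> : a + b - a = b by ring.
apply: Rle_trans (_ : INR (minn n h) * 1 <= _).
  by apply: nsum_abs_le.
by rewrite Rmult_1_r; apply: le_INR; lia.
Qed.

(** * Van der Corput's method for finite differences *)

Fixpoint diff (j : nat) (f : nat -> R) (k : nat) : R :=
  match j with
  | O => f k
  | S j' => diff j' (fun i => f i.+1 - f i) k
  end.

Lemma diff_ext j f g k : (forall i, f i = g i) -> diff j f k = diff j g k.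
Proof.
elim: j f g => [|j IH] f g H /=; first exact: H.
by apply: IH => i; rewrite !H.
Qed.

Lemma diff_plus j f g k : diff j (fun i => f i + g i) k = diff j f k + diff j g k.
Proof.
elim: j f g => [//|j IH] f g /=.
by rewrite -IH; apply: diff_ext => i; ring.
Qed.

Lemma diff_scal j c f k : diff j (fun i => c * f i) k = c * diff j f k.
Proof.
elim: j f => [//|j IH] f /=.
by rewrite -IH; apply: diff_ext => i; ring.
Qed.

Lemma diff_const j c k : diff j.+1 (fun _ => c) k = 0.
Proof.
have -> : diff j.+1 (fun _ => c) k = diff j (fun _ => 0 * 0) k.
  by rewrite /=; apply: diff_ext => i; ring.
by rewrite diff_scal; ring.
Qed.

Lemma diff_shift j f h k : diff j (fun i => f (i + h)%N) k = diff j f (k + h)%N.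
Proof.
elim: j f => [//|j IH] f /=.
by rewrite -IH; apply: diff_ext => i; rewrite addSn.
Qed.

(** Weyl differencing with shift [h] turns [j]-th differences into sums of [h] differences of order
    [j.+1], so two-sided bounds are simply multiplied by [h]. *)
Lemma diff_increment j f h k :
  diff j (fun i => f (i + h)%N - f i) k =
  nsum h (fun i => diff j.+1 f (k + i)%N).
Proof.
elim: h => [|h IH].
  have -> : diff j (fun i => f (i + 0)%N - f i) k = diff j (fun _ => 0 * 0) k.
    by apply: diff_ext => i; rewrite addn0; ring.
  by rewrite diff_scal /=; ring.
rewrite [RHS]/= -IH -(@diff_shift j (fun i => f i.+1 - f i) h k) -diff_plus.
by apply: diff_ext => i; rewrite addnS; ring.
Qed.

Lemma sin_ge_half x : 0 <= x <= 1 -> x / 2 <= sin x.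
Proof.
move=> Hx; have := pre_sin_bound x 0 _ _.
case; [lra | lra | rewrite /sin_approx /sum_f_R0 /sin_term /=].
by move=> H _; move: H; nra.
Qed.

(** Size and variation of the cotangent, the coefficient in the Abel summation below. The second
    bound comes from [cot x - cot y = sin (y - x) / (sin x * sin y)]. *)
Lemma cot_dist x y a :
  0 < a <= x -> a <= y -> x <= 1 -> y <= 1 ->
  Rabs (cos x / sin x) <= 2 / a /\
  Rabs (cos x / sin x - cos y / sin y) <= 4 * Rabs (x - y) / a ^ 2.
Proof.
move=> Hx Hy Hx1 Hy1.
have sx : a / 2 <= sin x by have := @sin_ge_half x; lra.
have sy : a / 2 <= sin y by have := @sin_ge_half y; lra.
split.
  rewrite /Rdiv Rabs_mult Rabs_inv (Rabs_right (sin x)); last lra.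
  have C := COS_bound x.
  have : Rabs (cos x) <= 1 by apply: Rabs_le.
  have : / sin x <= / (a / 2) by apply: Rinv_le_contravar; lra.
  have -> : / (a / 2) = 2 * / a by field; lra.
  have : 0 < / sin x by apply: Rinv_0_lt_compat; lra.
  have := Rabs_pos (cos x).
  by nra.
have -> : cos x / sin x - cos y / sin y = sin (y - x) / (sin x * sin y).
  by rewrite sin_minus; field; lra.
have P : (a / 2) ^ 2 <= sin x * sin y by nra.
have Pa : 0 < a ^ 2 by nra.
rewrite /Rdiv Rabs_mult Rabs_inv (Rabs_right (sin x * sin y)); last nra.
have S1 : Rabs (sin (y - x)) <= Rabs (x - y).
  rewrite (Rabs_minus_sym x y).
  have B z : 0 <= z -> Rabs (sin z) <= z.
    move=> Hz; case: (Rle_lt_dec z 1) => Hz1; last first.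
      by have := SIN_bound z; move=> H; apply: Rabs_le; lra.
    case: (Req_dec z 0) => [->|nz]; first by rewrite sin_0 Rabs_R0; lra.
    have H1 := @sin_ge_half z; have H2 := sin_lt_x z.
    by apply: Rabs_le; lra.
  case: (Rle_lt_dec 0 (y - x)) => H; first by rewrite (Rabs_right (y - x)); [apply: B | lra].
  have -> : y - x = - (x - y) by ring.
  by rewrite sin_neg !Rabs_Ropp (Rabs_right (x - y)); [apply: B; lra | lra].
have I : / (sin x * sin y) <= 4 * / a ^ 2.
  have -> : 4 * / a ^ 2 = / ((a / 2) ^ 2) by field; lra.
  by apply: Rinv_le_contravar => //; nra.
have := Rabs_pos (sin (y - x)).
have : 0 < / (sin x * sin y) by apply: Rinv_0_lt_compat; nra.
by move: S1 I; set u := / _; set v := / _; nra.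
Qed.

Lemma abel_bound N s c C D :
  (forall k, Rabs (s k) <= 1) ->
  (forall k, (k <= N)%N -> Rabs (c k) <= C) ->
  (forall k, (k < N)%N -> Rabs (c k.+1 - c k) <= D) ->
  Rabs (nsum N.+1 (fun k => (s k.+1 - s k) * c k)) <= 2 * C + INR N * D.
Proof.
move=> Hs Hc Hd.
(* With the upper boundary term subtracted the induction closes; adding it back costs the second
   [C]. *)
have H : Rabs (nsum N.+1 (fun k => (s k.+1 - s k) * c k) - s N.+1 * c N) <=
   C + INR N * D.
  elim: N Hc Hd => [|N IH] Hc Hd.
    rewrite /=.
    have -> : 0 + (s 1%N - s O) * c O - s 1%N * c O = - (s O * c O) by ring.
    rewrite Rabs_Ropp Rabs_mult.
    have := Hs O; have := Hc O isT; have := Rabs_pos (s O); have := Rabs_pos (c O).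
    by nra.
  rewrite S_INR [nsum _ _]/=.
  have := IH (fun k Hk => Hc k (leqW Hk)) (fun k Hk => Hd k (leqW Hk)).
  set A := (nsum N.+1 _ - _) => HA.
  set X := (X in Rabs X).
  have -> : X = A - s N.+1 * (c N.+1 - c N) by rewrite /X /A /=; ring.
  have T := Rabs_triang A (- (s N.+1 * (c N.+1 - c N))).
  rewrite Rabs_Ropp Rabs_mult in T.
  have := Hs N.+1; have := Hd N (leqnn _); have := Rabs_pos (s N.+1).
  have := Rabs_pos (c N.+1 - c N).
  by rewrite /Rminus in T *; nra.
have := Hs N.+1; have := Hc N (leqnn _) => H1 H2.
have H3 : Rabs (s N.+1 * c N) <= C.
  rewrite Rabs_mult; have := Rabs_pos (s N.+1); have := Rabs_pos (c N); nra.
by move: H H3; rewrite /Rabs; repeat case: Rcase_abs => ?; lra.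
Qed.

(** [lam] is the scale of the [j]-th differences. The length [N] is separate from [n] because
    differencing shortens the sum while [n] remains the reference scale. The bound on the next
    difference controls the variation of the cotangents in order one, where no monotonicity is
    assumed. *)
Definition cos_sum_small (j : nat) : Prop :=
  forall delta M eps, 0 < delta -> 0 < M -> 0 < eps ->
  exists Rm eta, 0 < Rm /\ 0 < eta /\
  forall (n N : nat) (f : nat -> R) (lam : R),
    (0 < n)%N -> (N <= n)%N -> 0 < lam <= eta -> Rm <= lam * INR n ^ j ->
    (forall k, (k < N)%N -> delta * lam <= diff j f k <= M * lam) ->
    (forall k, (k < N)%N -> Rabs (diff j.+1 f k) <= M * lam / INR n) ->
    Rabs (nsum N (fun k => cos (f k))) <= eps * INR n.

(* Kusmin-Landau: [cos (f k)] is the increment of [sin f] times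
   [cot (theta / 2) / 2], up to a telescoping term. *)
Lemma cos_sum_small_1 : cos_sum_small 1.
Proof.
move=> delta M eps Hd HM He.
(* [K / lam] is half of the Abel bound, plus [1] for the telescoping cosines, where [1 <= / lam]. *)
set K := 4 / delta + 4 * M / delta ^ 2 + 1.
have HK : 0 < K.
  rewrite /K; have : 0 < 4 / delta by apply: Rdiv_lt_0_compat; lra.
  have : 0 < 4 * M / delta ^ 2 by apply: Rdiv_lt_0_compat; nra.
  by lra.
(* [lam <= 1 / M] keeps the half increments [th k] in the range where [sin_ge_half] applies;
   [lam * n >= K / eps] turns [K / lam] into [eps * n]. *)
exists (K / eps), (Rmin 1 (1 / M)); split; first exact: Rdiv_lt_0_compat.
split; first by apply: Rmin_glb_lt; [lra | apply: Rdiv_lt_0_compat; lra].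
move=> n N f lam Hn HN Hlam HR H1 H2.
have Hn' : 0 < INR n by apply: lt_0_INR; lia.
have Hl1 : lam <= 1 by have := Rmin_l 1 (1 / M); lra.
have HlM : M * lam <= 1.
  have : lam <= 1 / M by have := Rmin_r 1 (1 / M); lra.
  by move=> /(Rmult_le_compat_l M _ _ (Rlt_le _ _ HM)); rewrite /Rdiv Rmult_1_l Rinv_r; lra.
rewrite pow_1 in HR.
case: N HN H1 H2 => [|N] HN H1 H2; first by rewrite /= Rabs_R0; nra.
pose th k := (f k.+1 - f k) / 2.
pose c k := cos (th k) / sin (th k).
have Hth k : (k <= N)%N -> delta * lam / 2 <= th k <= 1.
  by move=> Hk; move: (H1 k Hk); rewrite /th /=; lra.
have Ha : 0 < delta * lam / 2 by nra.
have E : nsum N.+1 (fun k => cos (f k)) =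
  / 2 * nsum N.+1 (fun k => (sin (f k.+1) - sin (f k)) * c k)
  - / 2 * (cos (f N.+1) - cos (f O)).
  rewrite -(nsum_telescope N.+1 (fun k => cos (f k))) -!nsum_scal -nsum_minus.
  apply: nsum_ext => k Hk.
  have Hs : 0 < sin (th k) by have := @sin_ge_half (th k); move: (Hth k Hk); lra.
  have Ef : f k.+1 = f k + 2 * th k by rewrite /th; field.
  rewrite Ef sin_plus cos_plus sin_2a cos_2a /c.
  have := sin2_cos2 (th k); rewrite /Rsqr => E2.
  field_simplify; last lra.
  field_simplify_eq; last lra.
  have E3 : cos (th k) * cos (th k) = 1 - sin (th k) * sin (th k) by lra.
  have E4 : cos (th k) ^ 2 = 1 - sin (th k) ^ 2 by lra.
  by ring [E3 E4].
have B : Rabs (nsum N.+1 (fun k => (sin (f k.+1) - sin (f k)) * c k)) <=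
  2 * (2 / (delta * lam / 2)) +
  INR N * (4 * (M * lam / INR n / 2) / (delta * lam / 2) ^ 2).
  apply: abel_bound.
  - by move=> k; have := SIN_bound (f k); move=> ?; apply: Rabs_le.
  - move=> k Hk; have Hk' := Hth k Hk.
    by have [|||| C _] := @cot_dist (th k) (th k) (delta * lam / 2); try lra.
  - move=> k Hk; have Ha1 := Hth k (ltnW Hk); have Hb := Hth k.+1 Hk.
    have [|||| _ C] := @cot_dist (th k.+1) (th k) (delta * lam / 2); try lra.
    apply: Rle_trans C _; apply: Rmult_le_compat_r.
      by apply/Rlt_le/Rinv_0_lt_compat; nra.
    have := H2 k (ltnW Hk); rewrite /= => D.
    have -> : th k.+1 - th k = / 2 * (f k.+2 - f k.+1 - (f k.+1 - f k)).
      by rewrite /th; field.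
    by rewrite Rabs_mult Rabs_right; lra.
have HNn : INR N <= INR n by apply: le_INR; lia.
have B2 : Rabs (nsum N.+1 (fun k => cos (f k))) <= K / lam.
  have Cb : Rabs (cos (f N.+1) - cos (f O)) <= 2.
    by have := COS_bound (f N.+1); have := COS_bound (f O) => ? ?; apply: Rabs_le; lra.
  have Z : INR N * (4 * (M * lam / INR n / 2) / (delta * lam / 2) ^ 2) <=
     8 * M / delta ^ 2 / lam.
    have -> : INR N * (4 * (M * lam / INR n / 2) / (delta * lam / 2) ^ 2) =
      (INR N / INR n) * (8 * M / delta ^ 2 / lam) by field; lra.
    rewrite -[X in _ <= X]Rmult_1_l; apply: Rmult_le_compat_r.
      by apply/Rlt_le/Rdiv_lt_0_compat; [apply: Rdiv_lt_0_compat; nra | lra].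
    by apply/(Rdiv_le_1 _ _ Hn').
  have Y : 2 * (2 / (delta * lam / 2)) = 8 / delta / lam by field; lra.
  have EK : K / lam = 4 / delta / lam + 4 * M / delta ^ 2 / lam + / lam.
    by rewrite /K; field; lra.
  have L1 : 1 <= / lam by rewrite -Rinv_1; apply: Rinv_le_contravar; lra.
  have EZ : 8 * M / delta ^ 2 / lam = 2 * (4 * M / delta ^ 2 / lam) by field; lra.
  have EY : 8 / delta / lam = 2 * (4 / delta / lam) by field; lra.
  rewrite E EK; move: B Cb; rewrite Y EY; move: Z; rewrite EZ.
  by rewrite /Rabs; repeat case: Rcase_abs => ?; lra.
apply: Rle_trans B2 _.
apply: (Rmult_le_reg_r lam); first lra.
have -> : K / lam * lam = K by field; lra.
move: HR => /(Rmult_le_compat_r eps _ _ (Rlt_le _ _ He)).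
have -> : K / eps * eps = K by field; lra.
by lra.
Qed.

(** The sum is compared with its average over the [L] translates by [i * q]; Cauchy-Schwarz in [k]
    and the opened square leave a diagonal, worth [N / L], and correlations at shifts [(i - j) * q].
    The witness [Z] replaces a square root. *)
Lemma van_der_corput (f : nat -> R) (N L q : nat) (Y : R) :
  (0 < L)%N -> 0 <= Y ->
  (forall p, (0 < p < L)%N ->
     Rabs (nsum (N - p * q)%N (fun k => cos (f (k + p * q)%N - f k))) <= Y) ->
  exists Z, Z ^ 2 <= INR N * (INR N / INR L + Y + 3 * (INR L * INR q)) /\
  Rabs (nsum N (fun k => cos (f k))) <= 2 * (INR L * INR q) + Z.
Proof.
move=> HL Y0 HY.
have HL' : 0 < INR L by apply: lt_0_INR; lia.
have HN := pos_INR N; have Hq := pos_INR q.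
have cosb x : Rabs (cos x) <= 1 by apply: Rabs_le; apply: COS_bound.
pose W := nsum N (fun k => nsum L (fun i => cos (f (i * q + k)%N))).
exists (Rabs W / INR L); split; last first.
  have E : Rabs (W - INR L * nsum N (fun k => cos (f k))) <= INR L * (2 * (INR L * INR q)).
    rewrite /W nsum_exch -(nsum_const L) -nsum_minus.
    apply: nsum_abs_le => i Hi.
    apply: Rle_trans (nsum_shift_dist N (i * q)%N (fun k => cos (f k)) _) _.
      by move=> k; apply: cosb.
    by rewrite -mult_INR; apply: Rmult_le_compat_l; [lra | apply: le_INR; nia].
  apply: (Rmult_le_reg_l (INR L)) => //.
  have -> : INR L * (2 * (INR L * INR q) + Rabs W / INR L) =
    INR L * (2 * (INR L * INR q)) + Rabs W by field; lra.
  rewrite -{1}(Rabs_right (INR L)); last lra.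
  rewrite -Rabs_mult.
  by move: E; rewrite /Rabs; repeat case: Rcase_abs => ?; lra.
(* Of the [3 * (L * q)], two parts pay for translating the sum by [j * q] and one for cutting it to
   length [N - (i - j) * q]. *)
have corr i j : (i < L)%N -> (j < L)%N -> (j < i)%N ->
   Rabs (nsum N (fun k => cos (f (i * q + k)%N - f (j * q + k)%N))) <=
   Y + 3 * (INR L * INR q).
  move=> Hi Hj Hij.
  pose v k := cos (f (k + (i - j) * q)%N - f k).
  have Ev : nsum N (fun k => cos (f (i * q + k)%N - f (j * q + k)%N)) =
     nsum N (fun k => v (j * q + k)%N).
    by apply: nsum_ext => k _; rewrite /v; congr (cos (f _ - _)); nia.
  rewrite Ev.
  have A1 := @nsum_shift_dist N (j * q)%N v (fun k => cosb _).
  have A2 := @nsum_trunc_dist N ((i - j) * q)%N v (fun k => cosb _).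
  have A3 : Rabs (nsum (N - (i - j) * q)%N v) <= Y by apply: HY; lia.
  have A4 : INR (j * q)%N <= INR L * INR q.
    by rewrite -mult_INR; apply: le_INR; nia.
  have A5 : INR ((i - j) * q)%N <= INR L * INR q.
    by rewrite -mult_INR; apply: le_INR; nia.
  by move: A1 A2 A3; rewrite /Rabs; repeat case: Rcase_abs => ?; lra.
have CS : W ^ 2 <= INR N * nsum N (fun k => nsum L (fun i => nsum L (fun j =>
    cos (f (i * q + k)%N - f (j * q + k)%N)))).
  apply: Rle_trans (nsum_cauchy_schwarz _ _) _.
  apply: Rmult_le_compat_l => //; apply: nsum_le => k _.
  rewrite (cos_sum_sqr L (fun i => f (i * q + k)%N)).
  by have := pow2_ge_0 (nsum L (fun i => sin (f (i * q + k)%N))); lra.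
pose Y' := Y + 3 * (INR L * INR q).
have BD : nsum N (fun k => nsum L (fun i => nsum L (fun j =>
    cos (f (i * q + k)%N - f (j * q + k)%N)))) <=
    INR L * (INR N + INR L * Y').
  rewrite nsum_exch -nsum_const; apply: nsum_le => i Hi.
  rewrite nsum_exch.
  apply: Rle_trans (_ : nsum L (fun j => (if i == j then INR N else 0) + Y') <= _).
    apply: nsum_le => j Hj; case: eqP => [<-|/eqP ne].
      rewrite (@nsum_ext N _ (fun _ => 1)); first by rewrite nsum_const /Y'; nra.
      by move=> k _; rewrite Rminus_diag cos_0.
    rewrite Rplus_0_l; apply: Rle_trans (Rle_abs _) _.
    case: (ltnP j i) => ij; first exact: corr.
    rewrite (@nsum_ext N _ (fun k => cos (f (j * q + k)%N - f (i * q + k)%N))).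
      by apply: corr => //; lia.
    by move=> k _; rewrite -cos_neg; congr cos; ring.
  by rewrite nsum_plus nsum_delta // nsum_const; lra.
have -> : (Rabs W / INR L) ^ 2 = W ^ 2 / INR L ^ 2.
  by rewrite /Rdiv Rpow_mult_distr pow2_abs pow_inv.
apply: (Rmult_le_reg_r (INR L ^ 2)); first by apply: pow_lt.
rewrite /Rdiv Rmult_assoc Rinv_l ?Rmult_1_r; last by apply: pow_nonzero; lra.
apply: Rle_trans CS _; rewrite Rmult_assoc; apply: Rmult_le_compat_l => //.
apply: Rle_trans BD _; right; rewrite /Y'; field; lra.
Qed.

Lemma nat_above x : exists n : nat, (0 < n)%N /\ x <= INR n.
Proof.
case: (Rle_lt_dec x 0) => Hx; first by exists 1%N; split => //; simpl; lra.
have [n Hn] := nfloor_ex x (Rlt_le _ _ Hx).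
by exists n.+1; split => //; rewrite S_INR; lra.
Qed.

(* Weyl differencing lowers the order by one; shifting by the multiples
   [p * q], [p < L], of a step [q] with [L] fixed keeps every difference in
   the range where the lower order case applies. *)
Lemma cos_sum_small_S j : (0 < j)%N -> cos_sum_small j -> cos_sum_small j.+1.
Proof.
move=> Hj IH delta M eps Hd HM Heps.
(* Capping at [1] gives [e ^ 2 <= e], so that the edge term [2 * e' * n] fits into [e / 2 * n]. *)
pose e := Rmin eps 1.
have He : 0 < e by apply: Rmin_glb_lt; lra.
have He1 : e <= 1 by apply: Rmin_r.
have Hee : e <= eps by apply: Rmin_l.
have He2 : 0 < e ^ 2 by apply: pow_lt.
(* Budget for [Z ^ 2 / n ^ 2]: at most [e ^ 2 / 16] each from the diagonal and the correlations and
   [3 * e ^ 2 / 32] from the edges, in all below [(e / 2) ^ 2]. *)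
have [L [HL HLe]] := nat_above (16 / e ^ 2).
have HL' : 1 <= INR L by apply: (le_INR 1); lia.
have [R' [eta' [HR' [Heta' IH']]]] := IH delta M (e ^ 2 / 16) Hd HM ltac:(lra).
pose e' := e ^ 2 / 32.
have He' : 0 < e' by rewrite /e'; lra.
(* A lower bound for [n]. It need not be assumed: [lam <= 1] and [lam * n ^ j.+1 >= X ^ j.+1 + 1]
   force [n >= X]. *)
pose X := Rmax (2 * INR L * R' / eta') (2 * INR L / e').
have X0 : 0 <= X.
  apply: Rle_trans (Rmax_r _ _).
  by apply/Rlt_le/Rdiv_lt_0_compat; lra.
exists (Rmax (2 * INR L * R' / e') (X ^ j.+1 + 1)), (Rmin 1 (eta' / (2 * INR L))).
split.
  by apply: Rlt_le_trans (Rmax_r _ _); have := pow_le X j.+1 X0; lra.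
split; first by apply: Rmin_glb_lt; [lra | apply: Rdiv_lt_0_compat; lra].
move=> n N f lam Hn HN [Hlam Hlam2] HR H1 H2.
have Hl1 : lam <= 1 by apply: Rle_trans Hlam2 (Rmin_l _ _).
have Hl2 : lam <= eta' / (2 * INR L) by apply: Rle_trans Hlam2 (Rmin_r _ _).
have Hn' : 0 < INR n by apply: lt_0_INR; lia.
have Hnj : 0 < INR n ^ j by apply: pow_lt.
have Hn1 : 1 <= INR n by apply: (le_INR 1); lia.
have nX : X <= INR n.
  case: (Rle_lt_dec X (INR n)) => // lt.
  have P : INR n ^ j.+1 <= X ^ j.+1 by apply: pow_incr; lra.
  have := Rle_trans _ _ _ (Rmax_r (2 * INR L * R' / e') (X ^ j.+1 + 1)) HR.
  have := pow_lt _ j.+1 Hn'.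
  by nra.
have nX1 : 2 * INR L * R' <= INR n * eta'.
  apply/(Rle_div_l _ _ _ Heta'); apply: Rle_trans nX; exact: Rmax_l.
have nX2 : 2 * INR L <= INR n * e'.
  apply/(Rle_div_l _ _ _ He'); apply: Rle_trans nX; exact: Rmax_r.
have HR1 : 2 * INR L * R' <= lam * INR n ^ j.+1 * e'.
  apply/(Rle_div_l _ _ _ He'); apply: Rle_trans HR; exact: Rmax_l.
have Hx : 0 < R' / (lam * INR n ^ j) by apply: Rdiv_lt_0_compat => //; nra.
(* The step [q] is the first integer above [R' / (lam * n ^ j)]: large enough that
   [q * lam * n ^ j >= R'], the lower order threshold, and small enough for the bounds [A] and
   [B]. *)
have [q0 Hq0] := nfloor_ex _ (Rlt_le _ _ Hx).
pose q := q0.+1.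
have Hq : R' / (lam * INR n ^ j) <= INR q <= 1 + R' / (lam * INR n ^ j).
  by rewrite /q S_INR; lra.
have Hq1 : R' <= INR q * (lam * INR n ^ j).
  by apply/Rle_div_l; [apply: Rmult_lt_0_compat | lra].
have Hq2 : INR q * (lam * INR n ^ j) <= lam * INR n ^ j + R'.
  have P : 0 < lam * INR n ^ j by apply: Rmult_lt_0_compat.
  have := Rmult_le_compat_r _ _ _ (Rlt_le _ _ P) (proj2 Hq).
  have -> : (1 + R' / (lam * INR n ^ j)) * (lam * INR n ^ j) = lam * INR n ^ j + R'.
    by field; lra.
  by [].
have A : INR L * INR q <= e' * INR n.
  apply: (Rmult_le_reg_r (lam * INR n ^ j)); first exact: Rmult_lt_0_compat.
  have : INR L * (INR q * (lam * INR n ^ j)) <= INR L * (lam * INR n ^ j + R').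
    by apply: Rmult_le_compat_l; lra.
  have : 2 * INR L * (lam * INR n ^ j) <= INR n * e' * (lam * INR n ^ j).
    by apply: Rmult_le_compat_r => //; apply/Rlt_le/Rmult_lt_0_compat.
  by move: HR1; rewrite /=; lra.
(* All shifted scales stay below [eta']. Here [0 < j] enters, through [n <= n ^ j]. *)
have B : lam * (INR L * INR q) <= eta'.
  have P1 : INR n <= INR n ^ j.
    by rewrite -{1}(pow_1 (INR n)); apply: Rle_pow => //; lia.
  have P2 : INR L * INR q * lam * INR n ^ j <= eta' * INR n ^ j.
    have : INR L * (INR q * (lam * INR n ^ j)) <= INR L * (lam * INR n ^ j + R').
      by apply: Rmult_le_compat_l; lra.
    have : 2 * INR L * R' <= INR n ^ j * eta'.
      apply: Rle_trans nX1 _; apply: Rmult_le_compat_r; lra.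
    have Q1 : lam * (2 * INR L) <= eta' by apply/(Rle_div_r _ _ _ _) => //; lra.
    have : lam * (2 * INR L) * INR n ^ j <= eta' * INR n ^ j.
      by apply: Rmult_le_compat_r => //; lra.
    by lra.
  by have := Rmult_le_reg_r _ _ _ Hnj P2; lra.
have [|||Z [HZ1 HZ2]] := @van_der_corput f N L q (e ^ 2 / 16 * INR n) => //.
- by apply: Rmult_le_pos; lra.
- move=> p /andP [Hp0 HpL].
  have Hpq : 0 < INR (p * q)%N by apply: lt_0_INR; rewrite /q; nia.
  have HpqL : INR (p * q)%N <= INR L * INR q.
    by rewrite -mult_INR; apply: le_INR; nia.
  apply: (IH' n (N - p * q)%N (fun k => f (k + p * q)%N - f k) (lam * INR (p * q)%N)) => //.
  + by lia.
  + split; first exact: Rmult_lt_0_compat.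
    by apply: Rle_trans B; apply: Rmult_le_compat_l => //; apply: Rlt_le.
  + apply: Rle_trans Hq1 _.
    have : INR q <= INR (p * q)%N by apply: le_INR; nia.
    move=> /(Rmult_le_compat_r (lam * INR n ^ j)) H.
    by have := H (Rlt_le _ _ (Rmult_lt_0_compat _ _ Hlam Hnj)); lra.
  + move=> k Hk; rewrite diff_increment.
    have -> : delta * (lam * INR (p * q)%N) = nsum (p * q) (fun _ => delta * lam).
      by rewrite nsum_const; ring.
    have -> : M * (lam * INR (p * q)%N) = nsum (p * q) (fun _ => M * lam).
      by rewrite nsum_const; ring.
    by split; apply: nsum_le => i Hi; have := H1 (k + i)%N ltac:(lia); lra.
  + move=> k Hk; rewrite diff_increment.
    have -> : M * (lam * INR (p * q)%N) / INR n = INR (p * q)%N * (M * lam / INR n).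
      by field; lra.
    by apply: nsum_abs_le => i Hi; apply: H2; lia.
have HNn : INR N <= INR n by apply: le_INR; lia.
have HN0 := pos_INR N.
have ZB : Z <= e / 2 * INR n.
  apply: Rsqr_incr_0_var; last by nra.
  rewrite !Rsqr_pow2; apply: Rle_trans HZ1 _.
  have iL : INR N / INR L <= e ^ 2 / 16 * INR n.
    apply/Rle_div_l; first lra.
    have : 16 <= INR L * e ^ 2 by apply/Rle_div_l.
    by nra.
  have : INR N * (INR N / INR L + e ^ 2 / 16 * INR n + 3 * (INR L * INR q)) <=
         INR n * (e ^ 2 / 4 * INR n).
    apply: Rmult_le_compat => //; last by rewrite /e' in A; nra.
    have : 0 <= INR N / INR L by apply: Rdiv_le_0_compat; lra.
    have : 0 <= INR L * INR q by apply: Rmult_le_pos; [lra | apply: pos_INR].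
    have : 0 <= e ^ 2 / 16 * INR n by apply: Rmult_le_pos; lra.
    by lra.
  by move=> H; apply: Rle_trans H _; right; field.
apply: Rle_trans HZ2 _.
apply: Rle_trans (_ : e * INR n <= _); last by apply: Rmult_le_compat_r; lra.
have : 2 * e' <= e / 2 by rewrite /e'; nra.
by nra.
Qed.

Lemma cos_sum_small_all j : (0 < j)%N -> cos_sum_small j.
Proof.
case: j => // j _; elim: j => [|j IH]; first exact: cos_sum_small_1.
exact: cos_sum_small_S.
Qed.

(** * Local power series expansions *)

Lemma CV_radius_geom_bound (a : nat -> R) M sg t :
  0 < sg -> (forall b, Rabs (a b) <= M / sg ^ b) -> Rabs t < sg ->
  Rbar_lt (Rabs t) (CV_radius a).
Proof.
move=> Hs Ha Ht.
apply: (Rbar_lt_le_trans _ sg) => //.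
have [ub _] := CV_radius_bounded a.
apply: ub; exists M => b.
have P := pow_lt _ b Hs.
rewrite Rabs_mult (Rabs_right (sg ^ b)); last lra.
apply: Rle_trans (_ : M / sg ^ b * sg ^ b <= _).
  by apply: Rmult_le_compat_r; [lra | apply: Ha].
by right; field; lra.
Qed.

Lemma PSeries_geom_bound (a : nat -> R) M sg t :
  0 < sg -> (forall b, Rabs (a b) <= M / sg ^ b) -> Rabs t <= sg / 2 ->
  Rabs (PSeries a t) <= 2 * M.
Proof.
move=> Hs Ha Ht.
have HM : 0 <= M by have := Ha O; have := Rabs_pos (a O); rewrite /= Rdiv_1_r; lra.
have T b : Rabs (a b * t ^ b) <= M * (/ 2) ^ b.
  rewrite Rabs_mult -RPow_abs.
  have P := pow_lt _ b Hs.
  have : Rabs t ^ b <= (sg / 2) ^ b by apply: pow_incr; split; [exact: Rabs_pos | lra].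
  rewrite /Rdiv Rpow_mult_distr => H.
  apply: Rle_trans (Rmult_le_compat _ _ _ _ (Rabs_pos _) _ (Ha b) H) _.
    by apply/pow_le/Rabs_pos.
  by right; rewrite /Rdiv; field; lra.
have G : ex_series (fun b => M * (/ 2) ^ b).
  by apply: (@ex_series_scal _ _ M); apply: ex_series_geom; rewrite Rabs_right; lra.
have Ab : ex_series (fun b => Rabs (a b * t ^ b)).
  by apply: (@ex_series_le R_AbsRing _ _ _ _ G) => b; rewrite /norm /= /abs /= Rabs_Rabsolu.
rewrite /PSeries; apply: Rle_trans (Series_Rabs _ Ab) _.
apply: Rle_trans (Series_le _ _ _ G) _.
  by move=> b; split; [exact: Rabs_pos | exact: T].
rewrite Series_scal_l Series_geom; last by rewrite Rabs_right; lra.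
by lra.
Qed.

(* What is kept of joint analyticity once the multi-indices in [x] are summed
   out; the clause with [eta] gives joint continuity of all [t]-derivatives. *)
Definition locexp {m : nat} (F : ('I_m -> R) -> R -> R) (p : 'I_m -> R) (s : R) :=
  exists sg M (C : ('I_m -> R) -> nat -> R), 0 < sg /\
  forall x, (forall j, Rabs (x j - p j) < sg) ->
    (forall b, Rabs (C x b) <= M / sg ^ b) /\
    (forall eta, 0 <= eta <= 1 -> (forall j, Rabs (x j - p j) <= eta * sg) ->
       forall b, Rabs (C x b - C p b) <= eta * M / sg ^ b) /\
    (forall t, Rabs (t - s) < sg -> F x t = PSeries (C x) (t - s)).

Section LocExp.
Context {m : nat}.
Implicit Types (F G : ('I_m -> R) -> R -> R) (p : 'I_m -> R) (s : R).

Lemma locexp_ext F G p s : (forall x t, F x t = G x t) -> locexp F p s -> locexp G p s.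
Proof.
move=> E [sg [M [C [Hs H]]]]; exists sg, M, C; split=> // x Hx.
have [H1 [H2 H3]] := H x Hx; split=> //; split=> // t Ht.
by rewrite -E; apply: H3.
Qed.

Lemma locexp_scal c F p s : locexp F p s -> locexp (fun x t => c * F x t) p s.
Proof.
move=> [sg [M [C [Hs H]]]]; exists sg, (Rabs c * M), (fun x => PS_scal c (C x)).
split=> // x Hx; have [H1 [H2 H3]] := H x Hx.
have Hc := Rabs_pos c.
rewrite /PS_scal; split.
  move=> b; rewrite /scal /= /mult /= Rabs_mult /Rdiv Rmult_assoc.
  by apply: Rmult_le_compat_l => //; apply: H1.
split.
  move=> eta Heta He b; rewrite /scal /= /mult /= -Rmult_minus_distr_l Rabs_mult.
  have -> : eta * (Rabs c * M) / sg ^ b = Rabs c * (eta * M / sg ^ b).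
    by rewrite /Rdiv; ring.
  by apply: Rmult_le_compat_l => //; apply: H2.
by move=> t Ht; rewrite PSeries_scal H3.
Qed.

Lemma locexp_plus F G p s :
  locexp F p s -> locexp G p s -> locexp (fun x t => F x t + G x t) p s.
Proof.
move=> [s1 [M1 [C1 [Hs1 H1]]]] [s2 [M2 [C2 [Hs2 H2]]]].
pose sg := Rmin s1 s2.
have Hs : 0 < sg by apply: Rmin_glb_lt.
have L1 : sg <= s1 by apply: Rmin_l.
have L2 : sg <= s2 by apply: Rmin_r.
have M1p : 0 <= M1.
  have [|B _] := H1 p; first by move=> j; rewrite Rminus_diag Rabs_R0.
  by have := B O; have := Rabs_pos (C1 p O); rewrite /= Rdiv_1_r; lra.
have M2p : 0 <= M2.
  have [|B _] := H2 p; first by move=> j; rewrite Rminus_diag Rabs_R0.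
  by have := B O; have := Rabs_pos (C2 p O); rewrite /= Rdiv_1_r; lra.
have mono M s' b : 0 <= M -> sg <= s' -> M / s' ^ b <= M / sg ^ b.
  move=> HM Hss; apply: Rmult_le_compat_l => //.
  by apply: Rinv_le_contravar; [exact: pow_lt | apply: pow_incr; lra].
exists sg, (M1 + M2), (fun x => PS_plus (C1 x) (C2 x)); split=> // x Hx.
have [|A1 [A2 A3]] := H1 x; first by move=> j; have := Hx j; lra.
have [|B1 [B2 B3]] := H2 x; first by move=> j; have := Hx j; lra.
rewrite /PS_plus /plus /=; split.
  move=> b; apply: Rle_trans (Rabs_triang _ _) _.
  have := mono _ _ b M1p L1; have := mono _ _ b M2p L2.
  by have := A1 b; have := B1 b; rewrite /Rdiv; lra.
split.
  move=> eta Heta He b.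
  have -> : C1 x b + C2 x b - (C1 p b + C2 p b) = (C1 x b - C1 p b) + (C2 x b - C2 p b) by ring.
  apply: Rle_trans (Rabs_triang _ _) _.
  have Q1 := A2 eta Heta (fun j => Rle_trans _ _ _ (He j) (Rmult_le_compat_l _ _ _ (proj1 Heta) L1)) b.
  have Q2 := B2 eta Heta (fun j => Rle_trans _ _ _ (He j) (Rmult_le_compat_l _ _ _ (proj1 Heta) L2)) b.
  have := mono (eta * M1) _ b ltac:(nra) L1; have := mono (eta * M2) _ b ltac:(nra) L2.
  by move: Q1 Q2; rewrite /Rdiv; lra.
move=> t Ht; rewrite A3; last lra; rewrite B3; last lra.
by rewrite PSeries_plus //; apply: CV_radius_inside;
  [apply: CV_radius_geom_bound A1 _ => //; lra | apply: CV_radius_geom_bound B1 _ => //; lra].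
Qed.

Lemma locexp_0 p s : locexp (fun _ _ => 0) p s.
Proof.
exists 1, 0, (fun _ _ => 0); split; first lra; move=> x _; split.
  by move=> b; rewrite Rabs_R0 /Rdiv; lra.
split; first by move=> eta _ _ b; rewrite Rminus_diag Rabs_R0 /Rdiv; lra.
by move=> t _; rewrite PSeries_const_0.
Qed.

Lemma locexp_rsum (I : finType) (Fi : I -> ('I_m -> R) -> R -> R) p s :
  (forall i, locexp (Fi i) p s) -> locexp (fun x t => rsum (fun i => Fi i x t)) p s.
Proof.
move=> H; rewrite /rsum.
elim: (index_enum I) => [|i r IH].
  by apply: locexp_ext (locexp_0 p s) => x t; rewrite big_nil.
by apply: locexp_ext (locexp_plus _ _ _ _ (H i) IH) => x t; rewrite big_cons.
Qed.

(** The factor [b.+1] produced by termwise differentiation is absorbed by halving the radius. *)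
Lemma succ_le_pow2 b : INR b.+1 <= 2 * 2 ^ b.
Proof.
elim: b => [|b IH]; first by simpl; lra.
by have := pow_R1_Rle 2 b; rewrite S_INR -tech_pow_Rmult; lra.
Qed.

(** Termwise differentiation: the derived coefficients satisfy bounds of the same shape with radius
    [sg / 2] and constant [2 * M / sg]. Existence of the derivative is recorded separately because
    [Derive] is total. *)
Lemma locexp_derive F p s : locexp F p s ->
  locexp (fun x => Derive (F x)) p s /\
  exists r, 0 < r /\ forall x t, (forall j, Rabs (x j - p j) < r) ->
    Rabs (t - s) < r -> ex_derive (F x) t.
Proof.
move=> [sg [M [C [Hs H]]]].
have D x t : (forall j, Rabs (x j - p j) < sg) -> Rabs (t - s) < sg ->
   is_derive (F x) t (PSeries (PS_derive (C x)) (t - s)).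
  move=> Hx Ht; have [H1 [_ H3]] := H x Hx.
  apply: (is_derive_ext_loc (fun u => PSeries (C x) (u - s))).
    have Hd : 0 < sg - Rabs (t - s) by lra.
    exists (mkposreal _ Hd) => u Hu; rewrite H3 //.
    have : Rabs (u - t) < sg - Rabs (t - s) by exact: Hu.
    have -> : u - s = (u - t) + (t - s) by ring.
    by have := Rabs_triang (u - t) (t - s); lra.
  rewrite -[PSeries (PS_derive _) _]Rmult_1_l.
  apply: (is_derive_comp (PSeries (C x)) (fun u => u - s)).
    by apply: is_derive_PSeries; apply: CV_radius_geom_bound H1 Ht.
  by auto_derive.
split; last first.
  by exists sg; split=> // x t Hx Ht; eexists; apply: D.
exists (sg / 2), (2 * M / sg), (fun x => PS_derive (C x)); split; first lra.
move=> x Hx.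
have [|H1 [H2 H3]] := H x; first by move=> j; have := Hx j; lra.
have bd (a : nat -> R) K b : 0 <= K -> (forall b, Rabs (a b) <= K / sg ^ b) ->
    Rabs (INR b.+1 * a b.+1) <= 2 * K / sg / (sg / 2) ^ b.
  move=> HK Ha; rewrite Rabs_mult Rabs_right; last by apply/Rle_ge/pos_INR.
  apply: Rle_trans (Rmult_le_compat _ _ _ _ (pos_INR _) (Rabs_pos _) (succ_le_pow2 b) (Ha b.+1)) _.
  right; rewrite /Rdiv Rpow_mult_distr pow_inv /=; field.
  by split; [apply: pow_nonzero; lra | split; [apply: pow_nonzero; lra | lra]].
have M0 : 0 <= M by have := H1 O; have := Rabs_pos (C x O); rewrite /= Rdiv_1_r; lra.
split; first by move=> b; apply: bd.
split; last first.
  by move=> t Ht; apply: is_derive_unique; apply: D => [j|]; [have := Hx j; lra | lra].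
move=> eta Heta He b.
rewrite /PS_derive -Rmult_minus_distr_l.
have -> : eta * (2 * M / sg) / (sg / 2) ^ b = 2 * (eta * M) / sg / (sg / 2) ^ b.
  by rewrite /Rdiv; ring.
apply: (bd (fun b => C x b - C p b)); first by nra.
by apply: H2 => // j; have := He j; nra.
Qed.

Lemma locexp_Derive_n F p s k :
  locexp F p s -> locexp (fun x => Derive_n (F x) k) p s.
Proof.
move=> H; elim: k => [//|k IH].
exact: (proj1 (locexp_derive _ _ _ IH)).
Qed.

Lemma locexp_continuous F p s eps : locexp F p s -> 0 < eps ->
  exists r, 0 < r /\ forall x t, (forall j, Rabs (x j - p j) < r) ->
    Rabs (t - s) < r -> Rabs (F x t - F p s) < eps.
Proof.
move=> [sg [M [C [Hs H]]]] He.
have Hp j : Rabs (p j - p j) < sg by rewrite Rminus_diag Rabs_R0.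
have [P1 [_ P3]] := H p Hp.
have M0 : 0 <= M by have := P1 O; have := Rabs_pos (C p O); rewrite /= Rdiv_1_r; lra.
have cont : continuity_pt (PSeries (C p)) 0.
  by apply: PSeries_continuity; apply: CV_radius_geom_bound P1 _ => //; rewrite Rabs_R0.
have [r1 [Hr1 Hc]] := cont (eps / 2) ltac:(lra).
(* The coefficients move by at most [eta * M / sg ^ b], hence the values within [sg / 2] of [s] by
   [2 * eta * M < eps / 2]; the other half of [eps] is spent on moving [t] with [p] fixed. *)
pose eta := Rmin 1 (eps / (4 * M + 4)).
have Heta : 0 < eta <= 1.
  by split; [apply: Rmin_glb_lt; [lra | apply: Rdiv_lt_0_compat; lra] | apply: Rmin_l].
have HetaM : 4 * (eta * M) < eps.
  have : eta * (4 * M + 4) <= eps by apply/Rle_div_r; [lra | apply: Rmin_r].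
  by nra.
exists (Rmin (Rmin r1 (sg / 2)) (eta * sg)); split.
  by apply: Rmin_glb_lt; [apply: Rmin_glb_lt; lra | nra].
move=> x t Hx Ht.
have m1 := Rmin_l (Rmin r1 (sg / 2)) (eta * sg).
have m2 := Rmin_r (Rmin r1 (sg / 2)) (eta * sg).
have m3 := Rmin_l r1 (sg / 2); have m4 := Rmin_r r1 (sg / 2).
have Hxs j : Rabs (x j - p j) < sg by have := Hx j; lra.
have [Q1 [Q2 Q3]] := H x Hxs.
have Et : F x t - F p t = PSeries (PS_minus (C x) (C p)) (t - s).
  rewrite PSeries_minus ?Q3 ?P3 //; try lra;
    apply: CV_radius_inside.
    by apply: CV_radius_geom_bound Q1 _ => //; lra.
  by apply: CV_radius_geom_bound P1 _ => //; lra.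
have B1 : Rabs (F x t - F p t) <= 2 * (eta * M).
  rewrite Et; apply: (PSeries_geom_bound _ _ sg) => //; last lra.
  by move=> b; apply: (Q2 eta) => [|j]; [lra | have := Hx j; lra].
have B2 : Rabs (F p t - F p s) < eps / 2.
  rewrite P3; last lra.
  rewrite P3 Rminus_diag; last by rewrite Rabs_R0.
  case: (Req_dec (t - s) 0) => [->|ne]; first by rewrite Rminus_diag Rabs_R0; lra.
  apply: (Hc (t - s)); split; first by split=> //; apply: not_eq_sym.
  by rewrite /= /Rdist Rminus_0_r; lra.
have -> : F x t - F p s = (F x t - F p t) + (F p t - F p s) by ring.
by apply: Rle_lt_trans (Rabs_triang _ _) _; lra.
Qed.

(** If [a k] is the first nonzero coefficient, the series is [t ^ k] times a continuous cofactor
    whose value at [0] is [a k]. *)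
Lemma PSeries_zero_dichotomy (a : nat -> R) :
  Rbar_lt 0 (CV_radius a) ->
  (forall b, a b = 0) \/
  exists r, 0 < r /\ forall t, t <> 0 -> Rabs t < r -> PSeries a t <> 0.
Proof.
move=> Ha.
case: (classic (forall b, a b = 0)) => [|/not_all_ex_not Hex]; first by left.
right.
have [k [Hk Hmin]] : exists k, a k <> 0 /\ forall i, (i < k)%N -> a i = 0.
  case: Hex => b; elim/ltn_ind: b => b IH Hb.
  case: (classic (exists i, (i < b)%N /\ a i <> 0)) => [[i [Hi Hai]]|H].
    exact: IH Hi Hai.
  exists b; split=> // i Hi; case: (Req_dec (a i) 0) => // Hai.
  by case: H; exists i.
have E t : PSeries a t = t ^ k * PSeries (PS_decr_n a k) t.
  by rewrite (PSeries_decr_n_aux a k) // => i Hi; apply: Hmin; lia.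
have cont : continuity_pt (PSeries (PS_decr_n a k)) 0.
  apply: PSeries_continuity; rewrite Rabs_R0.
  suff -> : CV_radius (PS_decr_n a k) = CV_radius a by [].
  elim: k {Hk Hmin E} => [|k IH]; first by apply: CV_radius_ext.
  rewrite -IH -(CV_radius_decr_1 (PS_decr_n a k)); apply: CV_radius_ext => i.
  by rewrite /PS_decr_1 /PS_decr_n; congr a; lia.
have V0 : PSeries (PS_decr_n a k) 0 = a k by rewrite PSeries_0 /PS_decr_n; congr a; lia.
have [r1 [Hr1 Hc]] := cont (Rabs (a k)) (Rabs_pos_lt _ Hk).
exists r1; split=> // t nt Ht.
rewrite E; apply: Rmult_integral_contrapositive_currified; first exact: pow_nonzero.
move=> Z.
have : Rdist (PSeries (PS_decr_n a k) t) (PSeries (PS_decr_n a k) 0) < Rabs (a k).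
  apply: Hc; split; first by split=> //; apply: not_eq_sym.
  by rewrite /= /Rdist Rminus_0_r.
by rewrite Z V0 /Rdist Rminus_0_l Rabs_Ropp; lra.
Qed.

Lemma locexp_zero_dichotomy F p s : locexp F p s ->
  (exists r, 0 < r /\ forall t, Rabs (t - s) < r -> F p t = 0) \/
  (exists r, 0 < r /\ forall t, t <> s -> Rabs (t - s) < r -> F p t <> 0).
Proof.
move=> [sg [M [C [Hs H]]]].
have [|P1 [_ P3]] := H p; first by move=> j; rewrite Rminus_diag Rabs_R0.
have [|Z|[r [Hr Z]]] := PSeries_zero_dichotomy (C p).
- by rewrite -Rabs_R0; apply: CV_radius_geom_bound P1 _ => //; rewrite Rabs_R0.
- left; exists sg; split=> // t Ht; rewrite P3 // (PSeries_ext _ (fun=> 0)) //.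
  by rewrite PSeries_const_0.
- right; exists (Rmin sg r); split; first exact: Rmin_glb_lt.
  move=> t nt Ht; rewrite P3; last by have := Rmin_l sg r; lra.
  by apply: Z; [lra | have := Rmin_r sg r; lra].
Qed.
End LocExp.

(** * Expansions of analytic families *)

Section FiniteSums.
Context {I : finType}.
Implicit Types F G : I -> R.

Lemma rsum_ext F G : (forall i, F i = G i) -> rsum F = rsum G.
Proof. by move=> H; apply: eq_bigr => i _; apply: H. Qed.

Lemma rsum_le F G : (forall i, F i <= G i) -> rsum F <= rsum G.
Proof.
move=> H; rewrite /rsum; apply: (big_ind2 Rle) => //; first exact: Rle_refl.
by move=> a b c e; apply: Rplus_le_compat.
Qed.

Lemma rsum_abs F : Rabs (rsum F) <= rsum (fun i => Rabs (F i)).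
Proof.
apply: (big_ind2 (fun a b => Rabs a <= b)).
- by rewrite Rabs_R0; right.
- by move=> a b c e H1 H2; apply: Rle_trans (Rabs_triang _ _) _; apply: Rplus_le_compat.
- by move=> i _; right.
Qed.

Lemma rsum_scal c F : rsum (fun i => c * F i) = c * rsum F.
Proof. by rewrite /rsum RmultE big_distrr. Qed.

Lemma rsum_plus F G : rsum (fun i => F i + G i) = rsum F + rsum G.
Proof. by rewrite /rsum RplusE -big_split. Qed.

Lemma rsum_minus F G : rsum (fun i => F i - G i) = rsum F - rsum G.
Proof.
rewrite /Rminus (rsum_plus F (fun i => - G i)); congr (_ + _).
have -> : - rsum G = -1 * rsum G by ring.
by rewrite -rsum_scal; apply: rsum_ext => i; ring.
Qed.

Lemma rsum_nonneg F : (forall i, 0 <= F i) -> 0 <= rsum F.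
Proof.
move=> H; rewrite /rsum; apply: (big_ind (Rle 0)) => //; first exact: Rle_refl.
by move=> a b; apply: Rplus_le_le_0_compat.
Qed.

Lemma rsum_term_le F i : (forall i, 0 <= F i) -> F i <= rsum F.
Proof.
move=> H; rewrite /rsum (bigD1 i) //= -RplusE -[X in X <= _]Rplus_0_r.
apply: Rplus_le_compat_l; apply: (big_ind (Rle 0)) => //; first exact: Rle_refl.
by move=> a b; apply: Rplus_le_le_0_compat.
Qed.

Lemma rsum_inj_le (J : finType) (h : I -> J) (G : J -> R) :
  injective h -> (forall j, 0 <= G j) -> rsum (fun i => G (h i)) <= rsum G.
Proof.
move=> ih HG; rewrite /rsum (bigID (mem [set h i | i in I])) /= -RplusE.
rewrite big_imset /=; last by move=> x y _ _; apply: ih.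
rewrite -[X in X <= _]Rplus_0_r; apply: Rplus_le_compat.
  by right; apply: eq_bigl.
apply: (big_ind (Rle 0)) => //; first exact: Rle_refl.
by move=> a b; apply: Rplus_le_le_0_compat.
Qed.
End FiniteSums.

Lemma rsum_exch (I J : finType) (F : I -> J -> R) :
  rsum (fun i => rsum (fun j => F i j)) = rsum (fun j => rsum (fun i => F i j)).
Proof. exact: exchange_big. Qed.

Lemma rsum_ord n (f : nat -> R) : rsum (fun k : 'I_n => f k) = nsum n f.
Proof.
rewrite /rsum; elim: n => [|n IH]; first by rewrite big_ord0.
by rewrite big_ord_recr /= IH.
Qed.

Section Boxes.
Context {m : nat}.
Implicit Types G H : ('I_m -> nat) -> R.

Definition box (G : ('I_m -> nat) -> R) (K : nat) : R :=
  rsum (fun a : {ffun 'I_m -> 'I_K.+1} => G (fun j => nat_of_ord (a j))).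

Lemma box_incr G K K' :
  (forall a, 0 <= G a) -> (K <= K')%N -> box G K <= box G K'.
Proof.
move=> HG; elim: K' => [|K' IH] HK.
  by right; congr box; lia.
case: (eqVneq K K'.+1) => [->|ne]; first by right.
apply: Rle_trans (IH _) _; first lia.
rewrite /box.
pose h (a : {ffun 'I_m -> 'I_K'.+1}) : {ffun 'I_m -> 'I_K'.+2} :=
  [ffun j => widen_ord (leqnSn _) (a j)].
have ih : injective h.
  move=> a b /ffunP E; apply/ffunP => j; move: (E j); rewrite !ffunE => /(congr1 val) /= E'.
  exact: val_inj.
apply: Rle_trans (rsum_inj_le _ h (fun a => G (fun j => nat_of_ord (a j))) ih _) => //.
right; apply: rsum_ext => a; congr G.
by apply: functional_extensionality => j; rewrite ffunE.
Qed.

(** [G = (|G| + G) - |G|] is a difference of nonnegative families, whose box sums are increasing and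
    bounded. *)
Lemma box_cvg G B : (forall K, box (fun a => Rabs (G a)) K <= B) ->
  is_lim_seq (box G) (real (Lim_seq (box G))).
Proof.
move=> HB.
have [l1 H1] : ex_finite_lim_seq (box (fun a => Rabs (G a))).
  apply: (ex_finite_lim_seq_incr _ B) => // K.
  by apply: box_incr => // a; apply: Rabs_pos.
have [l2 H2] : ex_finite_lim_seq (box (fun a => Rabs (G a) + G a)).
  apply: (ex_finite_lim_seq_incr _ (2 * B)).
    move=> K; apply: box_incr => // a.
    by have := Rle_abs (- G a); rewrite Rabs_Ropp; lra.
  move=> K; apply: Rle_trans (_ : 2 * box (fun a => Rabs (G a)) K <= _).
    rewrite /box -rsum_scal; apply: rsum_le => a.
    set b := (fun j => _); by have := Rle_abs (G b); lra.
  by have := HB K; lra.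
suff L : is_lim_seq (box G) (l2 - l1) by rewrite (is_lim_seq_unique _ _ L).
apply: is_lim_seq_ext (is_lim_seq_minus' _ _ _ _ H2 H1) => K.
by rewrite /box -rsum_minus; apply: rsum_ext => a; ring.
Qed.

Lemma box_Lim_le G H B :
  (forall a, Rabs (G a) <= H a) -> (forall K, box H K <= B) ->
  is_lim_seq (box G) (real (Lim_seq (box G))) /\ Rabs (Lim_seq (box G)) <= B.
Proof.
move=> HG HB.
have HK K : box (fun a => Rabs (G a)) K <= B.
  by apply: Rle_trans (HB K); apply: rsum_le => a; apply: HG.
have L := box_cvg _ _ HK; split=> //.
apply: (is_lim_seq_le (fun K => Rabs (box G K)) (fun _ => B) (Rabs (Lim_seq (box G))) B).
- by move=> K; apply: Rle_trans (rsum_abs _) (HK K).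
- exact: (is_lim_seq_abs _ _ L).
- exact: is_lim_seq_const.
Qed.

Lemma rprod_abs (I : finType) (u : I -> R) :
  Rabs (rprod u) = rprod (fun i => Rabs (u i)).
Proof.
apply: (big_ind2 (fun a b => Rabs a = b)) => //; first by rewrite Rabs_R1.
by move=> a b c e <- <-; exact: Rabs_mult.
Qed.

Lemma rprod_pos_le (I : finType) (u v : I -> R) :
  (forall i, 0 <= u i <= v i) -> 0 <= rprod u <= rprod v.
Proof.
move=> H; apply: (big_ind2 (fun a b => 0 <= a <= b)) => //; first by split; [apply: Rle_0_1 | right].
move=> a b c e H1 H2; rewrite -!RmultE; split.
  by apply: Rmult_le_pos; [case: H1 | case: H2].
by apply: Rmult_le_compat; tauto.
Qed.

Lemma monomial_le (sg : R) (y : 'I_m -> R) (a : 'I_m -> nat) :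
  (forall j, Rabs (y j) <= sg) ->
  Rabs (rprod (fun j => y j ^ a j)) <= rprod (fun j => sg ^ a j).
Proof.
move=> H; rewrite rprod_abs.
apply: (proj2 (rprod_pos_le _ _ _ _)) => j; rewrite -RPow_abs.
by split; [apply/pow_le/Rabs_pos | apply: pow_incr; split; [exact: Rabs_pos|]].
Qed.

(** A constant monomial does not move. Any other vanishes at [0] and has a positive exponent, from
    which one factor [eta] can be taken. *)
Lemma monomial_dist_le (sg eta : R) (y : 'I_m -> R) (a : 'I_m -> nat) :
  0 <= sg -> 0 <= eta <= 1 -> (forall j, Rabs (y j) <= eta * sg) ->
  Rabs (rprod (fun j => y j ^ a j) - rprod (fun j => 0 ^ a j)) <=
  eta * rprod (fun j => sg ^ a j).
Proof.
move=> Hs He H.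
have P0 : 0 <= rprod (fun j : 'I_m => sg ^ a j).
  by apply: (proj1 (rprod_pos_le _ _ (fun j => sg ^ a j) _)) => j; split; [apply: pow_le | right].
case: (boolP [forall j, a j == O]) => [/forallP Z|/forallPn [j0 Hj0]].
  have E u : rprod (fun j => u j ^ a j) = 1.
    by rewrite /rprod big1 // => j _; rewrite (eqP (Z j)).
  by rewrite !E Rminus_diag Rabs_R0; nra.
have -> : rprod (fun j => 0 ^ a j) = 0.
  rewrite /rprod (bigD1 j0) //= pow_i; last by lia.
  by rewrite -RmultE Rmult_0_l.
rewrite Rminus_0_r; apply: Rle_trans (monomial_le _ _ _ H) _.
have -> : rprod (fun j => (eta * sg) ^ a j) =
   rprod (fun j => eta ^ a j) * rprod (fun j => sg ^ a j).
  by rewrite /rprod RmultE -big_split; apply: eq_bigr => j _; rewrite Rpow_mult_distr.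
apply: Rmult_le_compat_r => //.
rewrite /rprod (bigD1 j0) //= -RmultE -[X in _ <= X]Rmult_1_r.
have B : 0 <= (\prod_(i < m | i != j0) pow eta (a i))%R <= 1.
  apply: (big_ind (fun z => 0 <= z <= 1)).
  - by split; [apply: Rle_0_1 | right].
  - by move=> u v Hu Hv; rewrite -RmultE; nra.
  - by move=> i _; split; [apply: pow_le; lra | rewrite -(pow1 (a i)); apply: pow_incr; lra].
apply: Rmult_le_compat => //; try tauto; first by apply: pow_le; lra.
case: (a j0) Hj0 => // k _.
rewrite -tech_pow_Rmult -[X in _ <= X]Rmult_1_r; apply: Rmult_le_compat_l; first lra.
by rewrite -(pow1 k); apply: pow_incr; lra.
Qed.
End Boxes.

Lemma nsum_geom_tail z B n :
  0 <= z < 1 -> nsum n (fun k => z ^ (B + k)%N) <= z ^ B / (1 - z).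
Proof.
move=> Hz.
suff -> : nsum n (fun k => z ^ (B + k)%N) = z ^ B * (1 - z ^ n) / (1 - z).
  apply: Rmult_le_compat_r; first by apply/Rlt_le/Rinv_0_lt_compat; lra.
  have := pow_le z B (proj1 Hz); have := pow_le z n (proj1 Hz); nra.
elim: n => [|n IH]; first by rewrite /=; field; lra.
by rewrite [nsum _ _]/= IH pow_add -tech_pow_Rmult; field; lra.
Qed.

Lemma is_lim_seq_nsum n (u : nat -> nat -> R) (l : nat -> R) :
  (forall b, (b < n)%N -> is_lim_seq (fun K => u K b) (l b)) ->
  is_lim_seq (fun K => nsum n (u K)) (nsum n l).
Proof.
elim: n => [|n IH] H /=; first exact: is_lim_seq_const.
by apply: is_lim_seq_plus'; [apply: IH => b Hb; apply: H; lia | apply: H].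
Qed.

(** Absolute convergence at the single corner point [(p + sg, s + sg)] majorizes every term on the
    smaller polydisc. Summing out the multi-index at fixed [b] gives [C x b], and the geometric
    bounds justify the change of summation order. *)
Lemma analytic_at_locexp (m : nat) (F : ('I_m -> R) -> R -> R) p s :
  analytic_at F p s -> locexp F p s.
Proof.
move=> [r [Hr [c Hc]]].
pose sg := r / 2.
have Hs : 0 < sg by rewrite /sg; lra.
have HsA : Rabs sg = sg by rewrite Rabs_right; lra.
have [||[M HM] _] := Hc (fun j => p j + sg) (s + sg).
- by move=> j; rewrite Rplus_minus_l HsA /sg; lra.
- by rewrite Rplus_minus_l HsA /sg; lra.
pose A b (a : 'I_m -> nat) := Rabs (c a b) * rprod (fun j => sg ^ a j).
have A0 b a : 0 <= A b a.
  apply: Rmult_le_pos; first exact: Rabs_pos.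
  by apply: (proj1 (rprod_pos_le _ _ (fun j => sg ^ a j) _)) => j; split; [apply: pow_le; lra | right].
have AM b K : box (A b) K <= M / sg ^ b.
  apply: Rle_trans (box_incr _ K (maxn K b) (A0 b) _) _; first lia.
  (* The box is enlarged so that the given exponent [b] occurs in the partial sum bounded by [M]. *)
  set K' := maxn K b; have Hb : (b < K'.+1)%N by rewrite /K'; lia.
  apply/Rle_div_r; first exact: pow_lt.
  apply: Rle_trans (HM K'); rewrite /ps_abs_partial /box Rmult_comm -rsum_scal.
  apply: rsum_le => a.
  pose T (b : 'I_K'.+1) := A b (fun j => nat_of_ord (a j)) * sg ^ b.
  have -> : sg ^ b * A b (fun j => nat_of_ord (a j)) = T (Ordinal Hb) by rewrite /T /=; ring.
  apply: Rle_trans (rsum_term_le T _ _) _.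
    by move=> i; apply: Rmult_le_pos => //; apply: pow_le; lra.
  right; apply: rsum_ext => i; rewrite /T /A Rplus_minus_l HsA; congr (_ * _ * _).
  by apply: eq_bigr => j _; rewrite Rplus_minus_l HsA.
pose g x b (a : 'I_m -> nat) := c a b * rprod (fun j => (x j - p j) ^ a j).
pose C x b := real (Lim_seq (box (g x b))).
have gA x b a : (forall j, Rabs (x j - p j) < sg) -> Rabs (g x b a) <= A b a.
  move=> Hx; rewrite /g Rabs_mult; apply: Rmult_le_compat_l; first exact: Rabs_pos.
  by apply: monomial_le => j; apply: Rlt_le.
exists sg, M, C; split=> // x Hx.
have M0 : 0 <= M.
  by have := AM O O; rewrite /= Rdiv_1_r; apply: Rle_trans; apply: rsum_nonneg => a; apply: A0.
have Hp j : Rabs (p j - p j) < sg by rewrite Rminus_diag Rabs_R0.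
have Lx b := box_Lim_le (g x b) (A b) _ (fun a => gA x b a Hx) (AM b).
have Lp b := box_Lim_le (g p b) (A b) _ (fun a => gA p b a Hp) (AM b).
split; first by move=> b; case: (Lx b).
split.
  move=> eta Heta He b.
  pose D a := g x b a - g p b a.
  have [|K|LD BD] := @box_Lim_le m D (fun a => eta * A b a) (eta * M / sg ^ b).
  - move=> a; rewrite /D /g -Rmult_minus_distr_l Rabs_mult /A.
    rewrite -Rmult_assoc (Rmult_comm eta) Rmult_assoc.
    apply: Rmult_le_compat_l; first exact: Rabs_pos.
    have -> : rprod (fun j => (p j - p j) ^ a j) = rprod (fun j => 0 ^ a j).
      by apply: eq_bigr => j _; rewrite Rminus_diag.
    by apply: monomial_dist_le => //; lra.
  - rewrite /box rsum_scal /Rdiv Rmult_assoc; apply: Rmult_le_compat_l; first lra.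
    exact: AM.
  - suff <- : real (Lim_seq (box D)) = C x b - C p b by [].
    have L := is_lim_seq_minus' _ _ _ _ (proj1 (Lx b)) (proj1 (Lp b)).
    rewrite (is_lim_seq_unique (box D) (C x b - C p b)) //.
    by apply: is_lim_seq_ext L => K; rewrite /box -rsum_minus.
move=> t Ht; symmetry; apply: is_pseries_unique.
have [||_ LF] := Hc x t.
- by move=> j; have := Hx j; rewrite /sg; lra.
- by move: Ht; rewrite /sg; lra.
set tau := t - s in Ht *.
pose z := Rabs tau / sg.
have Hz : 0 <= z < 1.
  split; first by apply: Rdiv_le_0_compat => //; apply: Rabs_pos.
  by apply/(Rdiv_lt_1 _ _ Hs).
have zE b : Rabs tau ^ b = z ^ b * sg ^ b.
  by rewrite -Rpow_mult_distr /z; congr (_ ^ _); field; lra.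
have psE K : ps_partial c p s x t K = nsum K.+1 (fun b => box (g x b) K * tau ^ b).
  rewrite /ps_partial rsum_exch -rsum_ord; apply: rsum_ext => b.
  by rewrite [RHS]Rmult_comm /box -rsum_scal; apply: rsum_ext => a; rewrite [RHS]Rmult_comm.
(* The limit in the box size [K] is taken at fixed [B], with a tail bound independent of [K]; only
   afterwards does [B] grow. *)
have tail B : Rabs (F x t - nsum B (fun b => C x b * tau ^ b)) <= M * (z ^ B / (1 - z)).
  pose u K := ps_partial c p s x t K - nsum B (fun b => box (g x b) K * tau ^ b).
  have Lu : is_lim_seq u (F x t - nsum B (fun b => C x b * tau ^ b)).
    apply: is_lim_seq_minus' => //.
    apply: (@is_lim_seq_nsum B (fun K b => box (g x b) K * tau ^ b)) => b Hb.
    by apply: is_lim_seq_mult' (is_lim_seq_const _); case: (Lx b).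
  apply: (is_lim_seq_le_loc (fun K => Rabs (u K)) (fun _ => M * (z ^ B / (1 - z)))
     (Rabs (F x t - nsum B (fun b => C x b * tau ^ b))) (M * (z ^ B / (1 - z)))).
  - exists B => K HK; rewrite /u psE.
    have -> : K.+1 = (B + (K.+1 - B))%N by lia.
    rewrite nsum_add Rplus_minus_l.
    apply: Rle_trans (nsum_abs _ _) _.
    apply: Rle_trans (Rmult_le_compat_l _ _ _ M0 (nsum_geom_tail z B (K.+1 - B)%N Hz)).
    rewrite -nsum_scal; apply: nsum_le => k _; rewrite Rabs_mult -RPow_abs zE.
    have -> : M * z ^ (B + k)%N = M / sg ^ (B + k)%N * (z ^ (B + k)%N * sg ^ (B + k)%N).
      by field; apply: pow_nonzero; lra.
    apply: Rmult_le_compat_r.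
      by apply: Rmult_le_pos; apply: pow_le; lra.
    apply: Rle_trans (rsum_abs _) _; apply: Rle_trans (AM _ K).
    by apply: rsum_le => a; apply: gA.
  - exact: (is_lim_seq_abs _ _ Lu).
  - exact: is_lim_seq_const.
have L : is_lim_seq (fun B => M * (z ^ B / (1 - z))) 0.
  have E0 : M * (0 * / (1 - z)) = 0 by ring.
  rewrite -[X in Rbar.Finite X]E0; apply: is_lim_seq_mult' (is_lim_seq_const _) _.
  apply: is_lim_seq_mult' (is_lim_seq_const _).
  by apply: is_lim_seq_geom; rewrite Rabs_right; lra.
have L0 : is_lim_seq (fun B => nsum B.+1 (fun b => C x b * tau ^ b)) (F x t).
  apply: (is_lim_seq_incr_1 (fun B => nsum B (fun b => C x b * tau ^ b)) _).1.
  apply: (is_lim_seq_le_le (fun B => F x t - M * (z ^ B / (1 - z))) _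
                           (fun B => F x t + M * (z ^ B / (1 - z)))).
  - by move=> B; have := tail B; rewrite /Rabs; case: Rcase_abs => ?; lra.
  - rewrite -{2}[F x t]Rminus_0_r; apply: is_lim_seq_minus' L; exact: is_lim_seq_const.
  - rewrite -{2}[F x t]Rplus_0_r; apply: is_lim_seq_plus' L; exact: is_lim_seq_const.
apply: is_lim_seq_ext L0 => B.
elim: B => [|B IH]; first by rewrite sum_O /= /scal /= /mult /= Rplus_0_l Rmult_1_r Rmult_1_l.
rewrite sum_Sn -IH [nsum B.+2 _]/= /plus /=; congr (_ + _).
by rewrite pow_n_pow /scal /= /mult /= Rmult_comm.
Qed.

(** * Compactness and isolated zeros *)

(** Continuous induction: the local property at the supremum [T] of the points reachable from [a]
    carries [P a] past [T], unless [b] is reached. *)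
Lemma interval_chain (P : R -> R -> Prop) a b : a <= b ->
  (forall u v w, a <= u -> u <= v -> v <= w -> w <= b -> P u v -> P v w -> P u w) ->
  (forall s, a <= s <= b -> exists r, 0 < r /\
     forall u v, a <= u -> u <= v -> v <= b -> s - r < u -> v < s + r -> P u v) ->
  P a b.
Proof.
move=> Hab Padd Ploc.
pose E v := a <= v <= b /\ P a v.
have Ea : E a.
  split; first lra.
  by have [|r [Hr H]] := Ploc a; [lra | apply: H; lra].
have [|| T [ubT lubT]] := completeness E.
- by exists b => v [Hv _]; lra.
- by exists a.
have HaT : a <= T by apply: ubT.
have HTb : T <= b by apply: lubT => v [Hv _]; lra.
have [|r [Hr H]] := Ploc T; first lra.
have [v [[Hv Pv] HvT]] : exists v, E v /\ T - r < v.
  apply: NNPP => no.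
  have : T <= T - r; last lra.
  apply: lubT => v Ev; case: (Rle_lt_dec v (T - r)) => // lt.
  by case: no; exists v.
have HvT2 : v <= T by apply: ubT.
pose w := Rmin b (T + r / 2).
have wb : w <= b by apply: Rmin_l.
have wT : w <= T + r / 2 by apply: Rmin_r.
have vw : v <= w by apply: Rmin_glb; lra.
have Pw : P a w.
  by apply: (Padd a v w) => //; try lra; apply: H; lra.
have : w <= T by apply: ubT; split=> //; lra.
move=> wT2; suff <- : w = b by [].
by move: wT2; rewrite /w /Rmin; case: Rle_dec => // _; lra.
Qed.

(** [tn_get] and [tn_of] translate between coordinate functions and the nested tuples on which
    [compactness_value] is stated. *)
Definition tn_get := fix tn_get (n : nat) : Compactness.Tn n R -> nat -> R :=
  match n with
  | O => fun _ _ => 0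
  | S n' => fun T k => match k with O => fst T | S k' => tn_get n' (snd T) k' end
  end.

Definition tn_of := fix tn_of (n : nat) (v : nat -> R) : Compactness.Tn n R :=
  match n with
  | O => tt
  | S n' => (v O, tn_of n' (fun k => v k.+1))
  end.

Lemma tn_getK n v k : (k < n)%N -> tn_get n (tn_of n v) k = v k.
Proof. by elim: n v k => [//|n IH] v [|k] Hk //=; rewrite IH. Qed.

Lemma bounded_nP n T : bounded_n n (tn_of n (fun=> 0)) (tn_of n (fun=> 1)) T <->
  forall k, (k < n)%N -> 0 <= tn_get n T k <= 1.
Proof.
elim: n T => [|n IH] /=; first by [].
case=> t T /=; rewrite IH; split.
  by move=> [H1 H2] [|k] Hk //; apply: H2.
by move=> H; split; [apply: (H O) | move=> k Hk; apply: (H k.+1)].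
Qed.

Lemma close_n_get n e T T' k :
  close_n n e T T' -> (k < n)%N -> Rabs (tn_get n T k - tn_get n T' k) < e.
Proof.
elim: n T T' k => [//|n IH] [t T] [t' T'] [|k] /= [H1 H2] Hk //.
exact: IH.
Qed.

(** A Lebesgue number. Since the chosen radius [r] satisfies [e <= r], any quantity encoded in
    [V p r] as a bound by [/ r] becomes uniform as well. *)
Lemma cube_lebesgue n (V : ('I_n -> R) -> R -> Prop) :
  (forall p, in_cube p -> exists r, 0 < r /\ V p r) ->
  exists e, 0 < e /\ forall x, in_cube x ->
    exists p r, [/\ in_cube p, V p r, e <= r & forall j, Rabs (x j - p j) < r].
Proof.
move=> HV.
pose vec T : 'I_n -> R := fun j => tn_get n T j.
(* The gauge must be defined on all tuples; outside the cube the radius [1] is a dummy. *)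
have HD T : exists r : posreal, in_cube (vec T) -> V (vec T) r.
  case: (classic (in_cube (vec T))) => H.
    by have [r [Hr HVr]] := HV _ H; exists (mkposreal r Hr).
  by exists (mkposreal 1 Rlt_0_1).
pose delta T := proj1_sig (constructive_indefinite_description _ (HD T)).
have deltaP T : in_cube (vec T) -> V (vec T) (delta T).
  by rewrite /delta; case: constructive_indefinite_description.
have [e He] := compactness_value n (tn_of n (fun=> 0)) (tn_of n (fun=> 1)) delta.
exists e; split; first exact: cond_pos.
move=> x Hx.
pose v k := if insub k is Some j then x j else 0.
have vE (j : 'I_n) : v j = x j by rewrite /v valK.
have [|T [HT [Hc Hd]]] := NNPP _ (He (tn_of n v) _).
  by apply/bounded_nP => k Hk; rewrite tn_getK // -[k]/(nat_of_ord (Ordinal Hk)) vE.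
have cT : in_cube (vec T) by move=> j; apply: (proj1 (bounded_nP _ _) HT).
exists (vec T), (delta T); split=> //; first exact: deltaP.
by move=> j; have := close_n_get _ _ _ _ _ Hc (ltn_ord j); rewrite tn_getK // vE.
Qed.

(** Mean value theorem for higher differences. The induction replaces the whole tower [D i] by its
    increments [D i (t + s) - D i t] on the interval shortened by [s], and the mean value theorem
    acts on the increment of [D j]. *)
Lemma diff_deriv_bounds j (D : nat -> R -> R) a b s c M u :
  0 < s ->
  (forall i t, a <= t <= b -> is_derive (D i) t (D i.+1 t)) ->
  (forall t, a <= t <= b -> c <= D j t <= M) ->
  a <= u -> u + INR j * s <= b ->
  c * s ^ j <= diff j (fun k => D O (u + INR k * s)) O <= M * s ^ j.
Proof.
move=> Hs; elim: j D b c M => [|j IH] D b c M HD HB Hu Hub.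
  rewrite /= Rmult_0_l Rplus_0_r !Rmult_1_r; apply: HB.
  by move: Hub; rewrite /=; lra.
rewrite S_INR in Hub.
have js : 0 <= INR j * s by apply: Rmult_le_pos; [apply: pos_INR | lra].
have -> : diff j.+1 (fun k => D O (u + INR k * s)) O =
  diff j (fun k => (fun i t => D i (t + s) - D i t) O (u + INR k * s)) O.
  apply: (@diff_ext j (fun i => D O (u + INR i.+1 * s) - D O (u + INR i * s))) => i.
  by rewrite S_INR; congr (D _ _ - _); ring.
rewrite -!tech_pow_Rmult -!Rmult_assoc.
apply: (IH (fun i t => D i (t + s) - D i t) (b - s)) => //; last lra.
  move=> i t Ht; apply: (is_derive_minus (fun t => D i (t + s)) (D i)); last by apply: HD; lra.
  rewrite -[D i.+1 (t + s)]Rmult_1_l.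
  by apply: (is_derive_comp (D i) (fun t => t + s)); [apply: HD; lra | auto_derive].
move=> t Ht.
have [|| x [Hx ->]] := MVT_gen (D j) t (t + s) (D j.+1).
- by rewrite Rmin_left ?Rmax_right; try lra; move=> x Hx; apply: HD; lra.
- rewrite Rmin_left ?Rmax_right; try lra; move=> x Hx.
  apply/continuity_pt_filterlim; apply: (ex_derive_continuous (D j)).
  by eexists; apply: HD; lra.
rewrite Rmin_left ?Rmax_right in Hx; try lra.
by have := HB x ltac:(lra); rewrite Rplus_minus_l; nra.
Qed.

(** A connectedness argument: the two local behaviours exclude each other and each persists nearby,
    so one of them holds on all of the interval. *)
Lemma zero_set_dichotomy (g : R -> R) a b :
  (forall s, a <= s <= b ->
    (exists r, 0 < r /\ forall t, Rabs (t - s) < r -> g t = 0) \/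
    (exists r, 0 < r /\ forall t, t <> s -> Rabs (t - s) < r -> g t <> 0)) ->
  (exists t, a <= t <= b /\ g t <> 0) ->
  forall s, a <= s <= b ->
    exists r, 0 < r /\ forall t, t <> s -> Rabs (t - s) < r -> g t <> 0.
Proof.
pose Z s := exists r, 0 < r /\ forall t, Rabs (t - s) < r -> g t = 0.
pose E s := exists r, 0 < r /\ forall t, t <> s -> Rabs (t - s) < r -> g t <> 0.
move=> H [t0 [Ht0 gt0]].
have excl s : Z s -> E s -> False.
  move=> [r1 [Hr1 H1]] [r2 [Hr2 H2]].
  pose r := Rmin r1 r2 / 2.
  have m0 : 0 < Rmin r1 r2 by apply: Rmin_glb_lt.
  have m1 := Rmin_l r1 r2; have m2 := Rmin_r r1 r2.
  have Hr : Rabs (s + r - s) = r by rewrite Rplus_minus_l Rabs_right /r; lra.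
  by apply: (H2 (s + r)); [rewrite /r; lra | rewrite Hr /r; lra | apply: H1; rewrite Hr /r; lra].
have : (forall s, a <= s <= b -> Z s) \/ (forall s, a <= s <= b -> E s).
  apply: (interval_chain (fun u v => (forall s, u <= s <= v -> Z s) \/ (forall s, u <= s <= v -> E s))).
  - lra.
  - move=> u v w Hu Huv Hvw Hw [H1|H1] [H2|H2].
    + by left=> s Hs; case: (Rle_lt_dec s v) => Hsv; [apply: H1 | apply: H2]; lra.
    + by case: (excl v); [apply: H1 | apply: H2]; lra.
    + by case: (excl v); [apply: H2 | apply: H1]; lra.
    + by right=> s Hs; case: (Rle_lt_dec s v) => Hsv; [apply: H1 | apply: H2]; lra.
  - move=> s Hs; case: (H s Hs) => [[r [Hr Hg]]|[r [Hr Hg]]]; exists r; split=> // u v Hu Huv Hv H1 H2.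
      left=> x Hx; have Hxs : Rabs (x - s) < r by apply: Rabs_def1; lra.
      exists (r - Rabs (x - s)); split; first lra.
      move=> t Ht; apply: Hg; have := Rabs_triang (t - x) (x - s).
      have -> : t - x + (x - s) = t - s by ring.
      lra.
    right=> x Hx; case: (Req_dec x s) => [->|nx]; first by exists r.
    have Hxs : Rabs (x - s) < r by apply: Rabs_def1; lra.
    have Hx0 : 0 < Rabs (x - s) by apply: Rabs_pos_lt; lra.
    exists (Rmin (r - Rabs (x - s)) (Rabs (x - s))); split; first by apply: Rmin_glb_lt; lra.
    move=> t _ Ht.
    have m1 := Rmin_l (r - Rabs (x - s)) (Rabs (x - s)).
    have m2 := Rmin_r (r - Rabs (x - s)) (Rabs (x - s)).
    apply: Hg; first by move=> ts; rewrite ts Rabs_minus_sym in Ht; lra.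
    have := Rabs_triang (t - x) (x - s).
    have -> : t - x + (x - s) = t - s by ring.
    lra.
case=> [HZ|//].
have [r [Hr Hg]] := HZ t0 Ht0.
by case: gt0; apply: Hg; rewrite Rminus_diag Rabs_R0.
Qed.

(** * Uniform bounds for cosine sums *)

Section Oscillation.
Variables (m : nat) (F : ('I_m -> R) -> R -> R) (kappa : nat) (rho : nat -> R).
Hypothesis kappa_gt0 : (0 < kappa)%N.
Hypothesis F_locexp : forall p s, in_cube p -> 0 <= s <= 1 -> locexp F p s.
Hypothesis rho_infty : is_lim_seq rho p_infty.
Hypothesis rho_small : is_lim_seq (fun n => rho n / INR n ^ kappa) 0.

(** The bound is relative to [n], not to the number of terms, and covers every block [[A, B)]
    sampled inside [[a, b]], so that blocks can be cut and rejoined. Radius and threshold are common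
    to all [x] near [p]. *)
Definition osc (p : 'I_m -> R) (e a b : R) : Prop :=
  exists r N, 0 < r /\ forall x n (A B : nat) th,
    in_cube x -> (forall j, Rabs (x j - p j) < r) -> (N <= n)%N -> (A <= B)%N ->
    a * INR n <= INR A -> INR B <= b * INR n ->
    Rabs (nsum (B - A)%N
      (fun k => cos (rho n * F x (INR (A + k)%N / INR n) + th))) <= e * INR n.

Lemma osc_le p e e' a b : e <= e' -> osc p e a b -> osc p e' a b.
Proof.
move=> He [r [N [Hr H]]]; exists r, N; split=> // x n A B th Hx Hxp Hn HAB Ha Hb.
apply: Rle_trans (H x n A B th _ _ _ _ _ _) _ => //.
by apply: Rmult_le_compat_r => //; apply: pos_INR.
Qed.

Lemma cos_abs_le1 x : Rabs (cos x) <= 1.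
Proof. by apply: Rabs_le; apply: COS_bound. Qed.

Lemma osc_length p a b : osc p (b - a) a b.
Proof.
exists 1, O; split; first lra; move=> x n A B th _ _ _ HAB Ha Hb.
apply: Rle_trans (nsum_abs_le _ _ 1 _) _; first by move=> k _; apply: cos_abs_le1.
by rewrite minus_INR; [lra | lia].
Qed.

(** A block straddling [b] is cut at [E], the integer part of [b * n]. The term of index [E] belongs
    to neither piece, and [eta * n >= 1] pays for it. *)
Lemma osc_split p e1 e2 eta a b c :
  0 <= a -> a <= b -> 0 <= e1 -> 0 <= e2 -> 0 < eta ->
  osc p e1 a b -> osc p e2 b c -> osc p (e1 + e2 + eta) a c.
Proof.
move=> Ha Hab He1 He2 Heta [r1 [N1 [Hr1 H1]]] [r2 [N2 [Hr2 H2]]].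
have [N3 [_ HN3]] := nat_above (/ eta).
exists (Rmin r1 r2), (maxn (maxn N1 N2) N3); split; first exact: Rmin_glb_lt.
move=> x n A B th Hx Hxp Hn HAB HA HB.
have X1 j : Rabs (x j - p j) < r1 by apply: Rlt_le_trans (Hxp j) (Rmin_l _ _).
have X2 j : Rabs (x j - p j) < r2 by apply: Rlt_le_trans (Hxp j) (Rmin_r _ _).
have n0 := pos_INR n.
have n1 : 1 <= eta * INR n.
  have : INR N3 <= INR n by apply: le_INR; lia.
  move=> /(Rle_trans _ _ _ HN3) /(Rmult_le_compat_l eta _ _ (Rlt_le _ _ Heta)).
  by rewrite Rinv_r; lra.
case: (Rle_lt_dec (INR B) (b * INR n)) => HBb.
  by apply: Rle_trans (H1 x n A B th _ _ _ _ _ _) _ => //; [lia | nra].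
case: (Rle_lt_dec (b * INR n) (INR A)) => HAb.
  by apply: Rle_trans (H2 x n A B th _ _ _ _ _ _) _ => //; [lia | nra].
have [E HE] := nfloor_ex (b * INR n) ltac:(nra).
have AE : (A <= E)%N.
  suff : (A < E.+1)%coq_nat by lia.
  by apply: INR_lt; rewrite S_INR; lra.
have EB : (E < B)%N.
  suff : (E < B)%coq_nat by lia.
  by apply: INR_lt; lra.
have -> : (B - A = (E - A) + (1 + (B - E.+1)))%N by lia.
rewrite !nsum_add.
have Q1 := H1 x n A E th Hx X1 ltac:(lia) AE HA (proj1 HE).
have Q2 : Rabs (nsum (B - E.+1) (fun k => cos (rho n * F x (INR (E.+1 + k)%N / INR n) + th)))
   <= e2 * INR n.
  by apply: H2 => //; [lia | rewrite S_INR; lra].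
have -> : nsum (B - E.+1) (fun k => cos (rho n * F x (INR (A + (E - A + (1 + k)))%N / INR n) + th)) =
   nsum (B - E.+1) (fun k => cos (rho n * F x (INR (E.+1 + k)%N / INR n) + th)).
  by apply: nsum_ext => k _; congr (cos (_ * F x (INR _ / _) + _)); lia.
rewrite [nsum 1 _]/= Rplus_0_l.
have Q3 := cos_abs_le1 (rho n * F x (INR (A + (E - A + 0))%N / INR n) + th).
apply: Rle_trans (Rabs_triang _ _) _.
apply: Rle_trans (Rplus_le_compat_l _ _ _ (Rabs_triang _ _)) _.
by lra.
Qed.

Let g x t := Derive_n (F x) kappa t.

Lemma F_is_derive x t i : in_cube x -> 0 <= t <= 1 ->
  is_derive (Derive_n (F x) i) t (Derive_n (F x) i.+1 t).
Proof.
move=> Hx Ht; apply: Derive_correct.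
have [_ [r [Hr H]]] := locexp_derive _ _ _ (locexp_Derive_n _ _ _ i (F_locexp _ _ Hx Ht)).
by apply: (H x t) => [j|]; rewrite Rminus_diag Rabs_R0.
Qed.

Lemma rho_range Rm eta : 0 < eta ->
  exists N, forall n, (N <= n)%N -> Rm <= rho n /\ rho n / INR n ^ kappa <= eta.
Proof.
move=> Heta.
have [N1 HN1] := (is_lim_seq_spec _ _).2 rho_infty Rm.
have [N2 HN2] := (is_lim_seq_spec _ _).2 rho_small (mkposreal _ Heta).
exists (maxn N1 N2) => n Hn; split.
  by apply/Rlt_le/HN1; lia.
have : Rabs (rho n / INR n ^ kappa - 0) < eta by apply: HN2; lia.
by rewrite Rminus_0_r => /Rabs_def2 [H _]; lra.
Qed.

(** Near [(p, s)] the derivative of order [kappa] keeps its sign and size and the next one is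
    bounded. Sampling at spacing [1 / n] gives differences of scale [lam = rho n / n ^ kappa], as
    [cos_sum_small] requires. *)
Lemma osc_near_nonzero p s : in_cube p -> 0 <= s <= 1 -> g p s <> 0 ->
  exists r, 0 < r /\ forall a b, 0 <= a -> a <= b -> b <= 1 -> s - r < a -> b < s + r ->
    forall e, 0 < e -> osc p e a b.
Proof.
move=> Hp Hs Hg.
have g0 : 0 < Rabs (g p s) by apply: Rabs_pos_lt.
have [r1 [Hr1 C1]] := locexp_continuous _ _ _ (Rabs (g p s) / 2)
   (locexp_Derive_n _ _ _ kappa (F_locexp _ _ Hp Hs)) ltac:(lra).
have [r2 [Hr2 C2]] := locexp_continuous _ _ _ 1
   (locexp_Derive_n _ _ _ kappa.+1 (F_locexp _ _ Hp Hs)) Rlt_0_1.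
pose delta := Rabs (g p s) / 2.
pose M := 2 * Rabs (g p s) + Rabs (Derive_n (F p) kappa.+1 s) + 1.
have HM : 0 < M by rewrite /M; have := Rabs_pos (Derive_n (F p) kappa.+1 s); lra.
pose r := Rmin r1 r2.
have rr1 : r <= r1 by apply: Rmin_l.
have rr2 : r <= r2 by apply: Rmin_r.
(* The differences must be positive; changing the sign of the phase leaves its cosine unchanged. *)
have [sn [Hsn1 Hsn2]] : exists sn, (sn = 1 \/ sn = -1) /\ sn * g p s = Rabs (g p s).
  by rewrite /Rabs; case: Rcase_abs => H; [exists (-1) | exists 1]; split; try lra; auto.
exists r; split; first exact: Rmin_glb_lt.
move=> a b Ha Hab Hb Har Hbr e He.
have [Rm [eta [HRm [Heta HS]]]] :=
  @cos_sum_small_all kappa kappa_gt0 delta M (e / 2) ltac:(rewrite /delta; lra) HM ltac:(lra).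
have [N1 HN1] := rho_range Rm eta Heta.
have [N2 [HN20 HN2]] := nat_above (2 * INR kappa.+1 / e).
exists r, (maxn N1 N2); split; first exact: Rmin_glb_lt.
move=> x n A B th Hx Hxp Hn HAB HA HB.
have [rhoR rhoE] := HN1 n ltac:(lia).
have n0 : 0 < INR n by apply: lt_0_INR; lia.
have nk : 0 < INR n ^ kappa by apply: pow_lt.
have ne : INR kappa.+1 <= e / 2 * INR n.
  have : INR N2 <= INR n by apply: le_INR; lia.
  move=> /(Rle_trans _ _ _ HN2) H.
  have : 2 * INR kappa.+1 <= INR n * e by apply/Rle_div_l.
  by lra.
pose f k := sn * (rho n * F x (INR (A + k)%N / INR n) + th).
have cosf k : cos (rho n * F x (INR (A + k)%N / INR n) + th) = cos (f k).
  rewrite /f; case: Hsn1 => ->; first by rewrite Rmult_1_l.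
  by rewrite -cos_neg; congr cos; ring.
rewrite (nsum_ext _ _ (fun k => cos (f k))); last by move=> k _; apply: cosf.
(* For the last [kappa.+1] terms the differences would sample beyond the block, so these terms are
   dropped. *)
have T := @nsum_trunc_dist (B - A)%N kappa.+1 (fun k => cos (f k)) (fun k => cos_abs_le1 _).
have BnA : INR B <= INR n by nra.
pose D i t := sn * Derive_n (F x) i t.
have bnd j c C k : (0 < j)%N -> (j <= kappa.+1)%N ->
  (forall t, a <= t <= b -> c <= D j t <= C) -> (k < B - A - kappa.+1)%N ->
  c * rho n / INR n ^ j <= diff j f k <= C * rho n / INR n ^ j.
  move=> Hj Hjk HD Hk.
  have -> : diff j f k = rho n * diff j (fun i => D O (INR (A + k)%N / INR n + INR i * / INR n)) O.
    rewrite -[k in LHS]add0n -diff_shift.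
    case: j Hj {Hjk HD} => // j _.
    rewrite -diff_scal -[LHS]Rplus_0_r -(@diff_const j (- (sn * th)) O) -diff_plus.
    apply: diff_ext => i; rewrite /f /D /=.
    have -> : INR (A + (i + k))%N / INR n = INR (A + k)%N / INR n + INR i * / INR n.
      have -> : (A + (i + k) = (A + k) + i)%N by lia.
      by rewrite plus_INR; field; lra.
    by ring.
  have [|||H1 H2] := @diff_deriv_bounds j D a b (/ INR n) c C (INR (A + k)%N / INR n) (Rinv_0_lt_compat _ n0) _ HD.
  - by move=> i t Ht; apply: is_derive_scal; apply: F_is_derive => //; lra.
  - apply/Rle_div_r => //; apply: Rle_trans HA _; apply: le_INR; lia.
  - apply: Rle_trans (_ : INR B / INR n <= _); last by apply/Rle_div_l.
    rewrite /Rdiv -Rmult_plus_distr_r -plus_INR; apply: Rmult_le_compat_r.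
      by apply/Rlt_le/Rinv_0_lt_compat.
    by apply: le_INR; lia.
  - move: H1 H2; rewrite pow_inv => H1 H2.
    have rp : 0 <= rho n by lra.
    by split; [have := Rmult_le_compat_l _ _ _ rp H1 | have := Rmult_le_compat_l _ _ _ rp H2]; rewrite /Rdiv; lra.
have near t : a <= t <= b -> Rabs (t - s) < r by move=> Ht; apply: Rabs_def1; lra.
pose lam := rho n / INR n ^ kappa.
have lam0 : 0 < lam by apply: Rdiv_lt_0_compat; lra.
have SM : Rabs (nsum (B - A - kappa.+1)%N (fun k => cos (f k))) <= e / 2 * INR n.
  apply: (HS n _ f lam) => //.
  - by lia.
  - suff : (B <= n)%coq_nat by lia.
    exact: INR_le.
  - by rewrite /lam; have -> : rho n / INR n ^ kappa * INR n ^ kappa = rho n by field; lra.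
  - move=> k Hk; have := bnd kappa delta M k kappa_gt0 (leqnSn _) _ Hk.
    rewrite /lam /Rdiv !Rmult_assoc; apply.
    move=> t Ht; have Q := C1 x t (fun j => Rlt_le_trans _ _ _ (Hxp j) rr1) (Rlt_le_trans _ _ _ (near t Ht) rr1).
    have : Rabs (sn * Derive_n (F x) kappa t - Rabs (g p s)) < Rabs (g p s) / 2.
      rewrite -{1}Hsn2 -Rmult_minus_distr_l Rabs_mult.
      have -> : Rabs sn = 1 by case: Hsn1 => ->; rewrite ?Rabs_Ropp Rabs_R1.
      by rewrite Rmult_1_l.
    move=> /Rabs_def2 [q1 q2]; rewrite /D /delta /M.
    by have := Rabs_pos (Derive_n (F p) kappa.+1 s); lra.
  - move=> k Hk; have := bnd kappa.+1 (- M) M k isT (leqnn _) _ Hk.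
    have -> : M * lam / INR n = M * rho n / INR n ^ kappa.+1.
      by rewrite /lam -tech_pow_Rmult; field; lra.
    move=> H; apply: Rabs_le; rewrite {1}/Rdiv !Ropp_mult_distr_l; apply: H.
    move=> t Ht; have Q := C2 x t (fun j => Rlt_le_trans _ _ _ (Hxp j) rr2) (Rlt_le_trans _ _ _ (near t Ht) rr2).
    suff : Rabs (D kappa.+1 t) <= M by move=> /Rabs_le_between.
    rewrite /D Rabs_mult.
    have -> : Rabs sn = 1 by case: Hsn1 => ->; rewrite ?Rabs_Ropp Rabs_R1.
    by move: Q; rewrite /M Rmult_1_l /Rabs; repeat case: Rcase_abs => ?; lra.
by move: T SM; rewrite /Rabs; repeat case: Rcase_abs => ?; lra.
Qed.

Lemma osc_chain p a b : 0 <= a -> a <= b -> b <= 1 ->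
  (forall s, a <= s <= b -> exists r, 0 < r /\ forall u v, a <= u -> u <= v -> v <= b ->
     s - r < u -> v < s + r -> forall e, 0 < e -> osc p e u v) ->
  forall e, 0 < e -> osc p e a b.
Proof.
move=> Ha Hab Hb; apply: interval_chain => // u v w Hu Huv Hvw Hw H1 H2 e He.
have -> : e = e / 3 + e / 3 + e / 3 by field.
by apply: (@osc_split _ _ _ _ u v w); try lra; [apply: H1 | apply: H2]; lra.
Qed.

Lemma osc_nonzero p a b : in_cube p -> 0 <= a -> a <= b -> b <= 1 ->
  (forall s, a <= s <= b -> g p s <> 0) -> forall e, 0 < e -> osc p e a b.
Proof.
move=> Hp Ha Hab Hb Hg; apply: osc_chain => // s Hs.
have [||r [Hr H]] := osc_near_nonzero p s Hp; [lra | exact: Hg |].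
by exists r; split=> // u v Hu Huv Hv H1 H2; apply: H; lra.
Qed.

(* The isolated zero [s] is cut out with an interval of length [2 eta]. *)
Lemma osc_unit_interval p : in_cube p -> (exists t, 0 <= t <= 1 /\ g p t <> 0) ->
  forall e, 0 < e -> osc p e 0 1.
Proof.
move=> Hp Hex; apply: osc_chain; try lra; move=> s Hs.
have dich s' : 0 <= s' <= 1 -> _ :=
  fun Hs' => locexp_zero_dichotomy _ _ _ (locexp_Derive_n _ _ _ kappa (F_locexp _ _ Hp Hs')).
have [r [Hr Z]] := zero_set_dichotomy (g p) 0 1 dich Hex s Hs.
exists r; split=> // u v Hu Huv Hv Hsu Hvs e He.
(* The pieces and the two splittings cost [6 * eta] in all. Clipping [l] and [w] to [[u, v]] also
   covers the case where [s] lies outside that interval. *)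
pose eta := e / 10.
pose l := Rmax u (Rmin v (s - eta)); pose w := Rmax u (Rmin v (s + eta)).
have [ul lv] : u <= l /\ l <= v.
  by split; [apply: Rmax_l | apply: Rmax_lub => //; apply: Rmin_l].
have wv : w <= v by apply: Rmax_lub => //; apply: Rmin_l.
have [lw wl] : l <= w /\ w - l <= 2 * eta.
  have : 0 < eta by rewrite /eta; lra.
  move=> ?; have : Rmin v (s - eta) <= Rmin v (s + eta) <= Rmin v (s - eta) + 2 * eta.
    by rewrite /Rmin; do 2 case: Rle_dec => [?|/Rnot_le_lt ?]; split; lra.
  by rewrite /l /w /Rmax; do 2 case: Rle_dec => [?|/Rnot_le_lt ?]; split; lra.
have eta0 : 0 < eta by rewrite /eta; lra.
have nz a b : u <= a -> a <= b -> b <= v -> b < s \/ s < a -> osc p eta a b.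
  move=> Hua Hab Hbv Hd; apply: osc_nonzero => //; try lra.
  by move=> t Ht; apply: Z; [lra | apply: Rabs_def1; lra].
have O1 : osc p eta u l.
  case: (Rle_lt_dec u (s - eta)) => Hc.
    apply: nz => //; try lra; left.
    have := Rmin_r v (s - eta) => H; have : l <= s - eta by apply: Rmax_lub.
    by lra.
  have -> : l = u by rewrite /l Rmax_left //; have := Rmin_r v (s - eta); lra.
  by apply: osc_le (osc_length _ _ _); lra.
have O2 : osc p (2 * eta) l w by apply: osc_le (osc_length _ _ _).
have O3 : osc p eta w v.
  case: (Rle_lt_dec (s + eta) v) => Hc.
    apply: nz => //; try lra.
    by right; apply: Rlt_le_trans (Rmax_r _ _); rewrite Rmin_right; lra.
  have -> : w = v by rewrite /w Rmin_left ?Rmax_right; lra.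
  by apply: osc_le (osc_length _ _ _); lra.
apply: (@osc_le _ ((eta + 2 * eta + eta) + eta + eta)); first by rewrite /eta; lra.
apply: (@osc_split _ _ _ _ u w v) => //; try lra.
by apply: (@osc_split _ _ _ _ u l w) => //; lra.
Qed.

Lemma cos_sum_uniform :
  (forall x, in_cube x -> exists t, 0 <= t <= 1 /\ Derive_n (F x) kappa t <> 0) ->
  forall e, 0 < e -> exists N, forall n x th, (N <= n)%N -> in_cube x ->
    Rabs (nsum n (fun k => cos (rho n * F x (INR k / INR n) + th))) <= e * INR n.
Proof.
move=> Hnd e He.
(* The threshold for [n] is hidden in the radius as [/ r], so one Lebesgue number makes both
   uniform. *)
pose V p r := forall x n th, in_cube x -> (forall j, Rabs (x j - p j) < r) -> / r <= INR n ->
  Rabs (nsum n (fun k => cos (rho n * F x (INR k / INR n) + th))) <= e * INR n.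
have [|d [Hd H]] := @cube_lebesgue m V.
  move=> p Hp; have [r [N [Hr HO]]] := osc_unit_interval p Hp (Hnd p Hp) e He.
  have Np : 0 < INR N.+1 by apply: lt_0_INR; lia.
  exists (Rmin r (/ INR N.+1)); split; first by apply: Rmin_glb_lt => //; apply: Rinv_0_lt_compat.
  move=> x n th Hx Hxp Hn.
  have := HO x n O n th Hx; rewrite subn0; apply.
  - by move=> j; apply: Rlt_le_trans (Hxp j) (Rmin_l _ _).
  - suff : (N.+1 <= n)%coq_nat by lia.
    apply: INR_le; apply: Rle_trans Hn; rewrite -[X in X <= _]Rinv_inv.
    apply: Rinv_le_contravar; last exact: Rmin_r.
    by apply: Rmin_glb_lt => //; apply: Rinv_0_lt_compat.
  - by [].
  - by rewrite /=; lra.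
  - by lra.
have [N [_ HN]] := nat_above (/ d).
exists N => n x th Hn Hx; have [p [r [Hp HV Hdr Hxr]]] := H x Hx.
apply: HV => //; apply: Rle_trans (_ : / d <= _); first exact: Rinv_le_contravar.
by apply: Rle_trans HN _; apply: le_INR; lia.
Qed.
End Oscillation.

(** * Fejer's kernel and iterated integrals *)

Lemma cos_Zperiod x (z : Z) : cos (x + 2 * PI * IZR z) = cos x.
Proof.
have N (n : nat) y : cos (y + 2 * PI * INR n) = cos y.
  by have := cos_period y n; rewrite (_ : y + 2 * INR n * PI = y + 2 * PI * INR n) //; ring.
case: (Z_le_gt_dec 0 z) => Hz.
  by rewrite -(Z2Nat.id z) // -INR_IZR_INZ N.
rewrite -(N (Z.to_nat (Z.opp z)) (x + _)) INR_IZR_INZ Z2Nat.id; last by lia.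
by rewrite opp_IZR; congr cos; ring.
Qed.

Lemma cos_ne1 x : - (2 * PI) < x < 2 * PI -> x <> 0 -> cos x <> 1.
Proof.
move=> Hx nx E; have := cos_2a_sin (x / 2).
have -> : 2 * (x / 2) = x by field.
rewrite E => S.
have : sin (x / 2) = 0 by nra.
have [lt|gt] : x < 0 \/ 0 < x by lra.
- move=> S0; have := sin_gt_0 (- (x / 2)); rewrite sin_neg; lra.
- by move=> S0; have := sin_gt_0 (x / 2); lra.
Qed.

(** The sum [S] is invariant under translation by [beta] because the angles run through full
    periods. The addition formula then gives [(1 - cos beta) * S alpha = 0], and [|h| < Q] excludes
    [cos beta = 1]. *)
Lemma roots_cos_sum_zero (Q : nat) (h : Z) alpha :
  (0 < Q)%N -> h <> Z0 -> Z.lt (Z.abs h) (Z.of_nat Q) ->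
  nsum Q (fun w => cos (alpha - 2 * PI * IZR h * (INR w / INR Q))) = 0.
Proof.
move=> HQ Hh HhQ.
have Q0 : 0 < INR Q by apply: lt_0_INR; lia.
pose beta := 2 * PI * IZR h / INR Q.
pose S a := nsum Q (fun w => cos (a - INR w * beta)).
have -> : nsum Q (fun w => cos (alpha - 2 * PI * IZR h * (INR w / INR Q))) = S alpha.
  by apply: nsum_ext => w _; congr cos; rewrite /beta; field; lra.
have shift a : S (a - beta) = S a.
  have T := nsum_telescope Q (fun w => cos (a - INR w * beta)).
  have EQ : cos (a - INR Q * beta) = cos a.
    have -> : a - INR Q * beta = a + 2 * PI * IZR (Z.opp h).
      by rewrite opp_IZR /beta; field; lra.
    exact: cos_Zperiod.
  rewrite EQ Rmult_0_l Rminus_0_r Rminus_diag nsum_minus in T.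
  have -> : S (a - beta) = nsum Q (fun k => cos (a - INR k.+1 * beta)).
    by apply: nsum_ext => w _; congr cos; rewrite S_INR; ring.
  by rewrite /S; lra.
have avg : S (alpha + beta) + S (alpha - beta) = 2 * cos beta * S alpha.
  rewrite /S -nsum_plus -nsum_scal; apply: nsum_ext => w _.
  set t := alpha - INR w * beta.
  have -> : alpha + beta - INR w * beta = t + beta by rewrite /t; ring.
  have -> : alpha - beta - INR w * beta = t - beta by rewrite /t; ring.
  by rewrite cos_plus cos_minus; ring.
have s1 := shift alpha; have s2 := shift (alpha + beta).
have E : alpha + beta - beta = alpha by ring.
rewrite E in s2.
have hne : IZR h <> 0 by apply: not_0_IZR.
have hb : - INR Q < IZR h < INR Q.
  by rewrite INR_IZR_INZ -opp_IZR; split; apply: IZR_lt; lia.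
have c1 : cos beta <> 1.
  have P := PI_RGT_0.
  apply: cos_ne1.
    rewrite /beta; split.
      by apply/Rlt_div_r => //; nra.
    by apply/Rlt_div_l => //; nra.
  rewrite /beta => /Rmult_integral [|/Rinv_neq_0_compat]; try lra.
  by case/Rmult_integral; lra.
have : (1 - cos beta) * S alpha = 0 by lra.
by case/Rmult_integral; lra.
Qed.

(** The form [|1 + z + ... + z^(M-1)|^2 / M], with [z = exp (i x)], left as a double sum so that a
    product with a character splits into characters. *)
Definition fejer (M : nat) (x : R) : R :=
  / INR M * nsum M (fun a => nsum M (fun b => cos (INR a * x - INR b * x))).

Lemma fejer_ge0 M x : 0 <= fejer M x.
Proof.
rewrite /fejer (cos_sum_sqr M (fun a => INR a * x)).
have S1 := pow2_ge_0 (nsum M (fun a => cos (INR a * x))).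
have S2 := pow2_ge_0 (nsum M (fun a => sin (INR a * x))).
case: M S1 S2 => [|M] S1 S2; first by rewrite /=; lra.
apply: Rmult_le_pos; last lra.
by apply/Rlt_le/Rinv_0_lt_compat; apply: lt_0_INR; lia.
Qed.

(* With [z = exp (i x)], [|1 - z|^2 |1 + z + ... + z^(M-1)|^2 = |1 - z^M|^2]. *)
Lemma fejer_concentration M x : (0 < M)%N -> (1 - cos x) * fejer M x <= 2 / INR M.
Proof.
move=> HM.
have M0 : 0 < INR M by apply: lt_0_INR; lia.
rewrite /fejer (cos_sum_sqr M (fun a => INR a * x)).
set C := nsum M _; set S := nsum M _.
have E1 : C - (cos x * C - sin x * S) = 1 - cos (INR M * x).
  rewrite /C /S -!nsum_scal -!nsum_minus.
  have := nsum_telescope M (fun k => cos (INR k * x)); rewrite Rmult_0_l cos_0 => T.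
  suff -> : nsum M (fun k => cos (INR k * x) - (cos x * cos (INR k * x) - sin x * sin (INR k * x)))
     = -1 * nsum M (fun k => cos (INR k.+1 * x) - cos (INR k * x)) by rewrite T; ring.
  rewrite -nsum_scal; apply: nsum_ext => k _.
  by rewrite S_INR Rmult_plus_distr_r Rmult_1_l cos_plus; ring.
have E2 : S - (sin x * C + cos x * S) = - sin (INR M * x).
  rewrite /C /S -!nsum_scal -nsum_plus -nsum_minus.
  have := nsum_telescope M (fun k => sin (INR k * x)); rewrite Rmult_0_l sin_0 => T.
  suff -> : nsum M (fun k => sin (INR k * x) - (sin x * cos (INR k * x) + cos x * sin (INR k * x)))
     = -1 * nsum M (fun k => sin (INR k.+1 * x) - sin (INR k * x)) by rewrite T; ring.
  rewrite -nsum_scal; apply: nsum_ext => k _.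
  by rewrite S_INR Rmult_plus_distr_r Rmult_1_l sin_plus; ring.
have T1 := sin2_cos2 x; have T2 := sin2_cos2 (INR M * x); rewrite /Rsqr in T1 T2.
have E3 : (1 - cos x) * (C ^ 2 + S ^ 2) = 1 - cos (INR M * x).
  have H : (C - (cos x * C - sin x * S)) ^ 2 + (S - (sin x * C + cos x * S)) ^ 2 =
     (1 - 2 * cos x + (sin x * sin x + cos x * cos x)) * (C ^ 2 + S ^ 2) by ring.
  have H' : (1 - cos (INR M * x)) ^ 2 + (- sin (INR M * x)) ^ 2 =
     1 - 2 * cos (INR M * x) + (sin (INR M * x) * sin (INR M * x) + cos (INR M * x) * cos (INR M * x)) by ring.
  by move: H; rewrite E1 E2 H' T1 T2; lra.
rewrite -Rmult_assoc (Rmult_comm (1 - cos x)) Rmult_assoc E3 Rmult_comm /Rdiv.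
apply: Rmult_le_compat_r; first by apply/Rlt_le/Rinv_0_lt_compat.
by have := COS_bound (INR M * x); lra.
Qed.

(** The frequencies [a - b] are smaller than [M <= Q] in absolute value, so the [Q]-point mean kills
    all but the diagonal: the discrete mean is exact. *)
Lemma fejer_mean (M Q : nat) u : (0 < M)%N -> (M <= Q)%N ->
  / INR Q * nsum Q (fun w => fejer M (2 * PI * (u - INR w / INR Q))) = 1.
Proof.
move=> HM HQ.
have M0 : 0 < INR M by apply: lt_0_INR; lia.
have Q0 : 0 < INR Q by apply: lt_0_INR; lia.
rewrite nsum_scal nsum_exch.
have -> : nsum M (fun a => nsum Q (fun w => nsum M (fun b =>
    cos (INR a * (2 * PI * (u - INR w / INR Q)) - INR b * (2 * PI * (u - INR w / INR Q)))))) =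
  nsum M (fun a => INR Q).
  apply: nsum_ext => a Ha; rewrite nsum_exch.
  transitivity (nsum M (fun b => if a == b then INR Q else 0)); last exact: nsum_delta.
  apply: nsum_ext => b Hb.
  case: eqP => [<-|ne].
    rewrite (@nsum_ext Q _ (fun=> 1)); first by rewrite nsum_const; ring.
    by move=> w _; rewrite Rminus_diag cos_0.
  pose h := Z.sub (Z.of_nat a) (Z.of_nat b).
  have hE : IZR h = INR a - INR b by rewrite minus_IZR -!INR_IZR_INZ.
  rewrite -(@roots_cos_sum_zero Q h (2 * PI * IZR h * u)); try lia.
  by apply: nsum_ext => w _; congr cos; rewrite hE; ring.
by rewrite nsum_const; field; lra.
Qed.

(** The constant [e] is averaged by a kernel of mean [1]; the part with [1 - cos] is controlled by
    [fejer_concentration]. *)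
Lemma fejer_approx (G : R -> R) e C (M Q : nat) u : (0 < M)%N -> (M <= Q)%N -> 0 <= C ->
  (forall w, Rabs (G u - G w) <= e + C * (1 - cos (2 * PI * (u - w)))) ->
  Rabs (G u - / INR Q * nsum Q (fun w => G (INR w / INR Q) * fejer M (2 * PI * (u - INR w / INR Q))))
  <= e + 2 * C / INR M.
Proof.
move=> HM HQ HC HG.
have M0 : 0 < INR M by apply: lt_0_INR; lia.
have Q0 : 0 < INR Q by apply: lt_0_INR; lia.
pose K w := fejer M (2 * PI * (u - INR w / INR Q)).
have one : nsum Q K = INR Q.
  apply: (Rmult_eq_reg_l (/ INR Q)); last by apply: Rinv_neq_0_compat; lra.
  by rewrite (fejer_mean M Q u HM HQ) Rinv_l //; lra.
have -> : G u - / INR Q * nsum Q (fun w => G (INR w / INR Q) * K w) =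
  / INR Q * nsum Q (fun w => (G u - G (INR w / INR Q)) * K w).
  have -> : nsum Q (fun w => (G u - G (INR w / INR Q)) * K w) =
    G u * nsum Q K - nsum Q (fun w => G (INR w / INR Q) * K w).
    by rewrite -nsum_scal -nsum_minus; apply: nsum_ext => w _; ring.
  by rewrite one; field; lra.
rewrite Rabs_mult (Rabs_right (/ INR Q)); last by apply/Rle_ge/Rlt_le/Rinv_0_lt_compat.
have -> : e + 2 * C / INR M = / INR Q * nsum Q (fun w => e * K w + C * (2 / INR M)).
  by rewrite nsum_plus nsum_scal nsum_const one; field; lra.
apply: Rmult_le_compat_l; first by apply/Rlt_le/Rinv_0_lt_compat.
apply: Rle_trans (nsum_abs _ _) _; apply: nsum_le => w _.
have Kp : 0 <= K w by apply: fejer_ge0.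
have Kc := fejer_concentration M (2 * PI * (u - INR w / INR Q)) HM.
rewrite Rabs_mult (Rabs_right (K w)); last lra.
apply: Rle_trans (Rmult_le_compat_r _ _ _ Kp (HG _)) _.
by rewrite Rmult_plus_distr_r Rmult_assoc; apply: Rplus_le_compat_l; apply: Rmult_le_compat_l.
Qed.

(** Functions of infinitely many coordinates, as in [iter_int]: freezing one coordinate then keeps
    the type, and the class is stable under it. *)
Definition unif_periodic (g : (nat -> R) -> R) : Prop :=
  [/\ forall e, 0 < e -> exists dl, 0 < dl /\
        forall u v, (forall k, Rabs (u k - v k) < dl) -> Rabs (g u - g v) <= e,
      forall v (z : nat -> Z), g (fun k => v k + IZR (z k)) = g v
    & exists B, forall v, Rabs (g v) <= B].

Definition upd (v : nat -> R) (j : nat) (s : R) : nat -> R :=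
  fun k => if Nat.eqb k j then s else v k.

Lemma unif_periodic_upd g j s : unif_periodic g -> unif_periodic (fun v => g (upd v j s)).
Proof.
move=> [H1 H2 [B H3]]; split; last by exists B.
  move=> e He; have [dl [Hd H]] := H1 e He; exists dl; split=> // u v Huv.
  by apply: H => k; rewrite /upd; case: Nat.eqb; rewrite // Rminus_diag Rabs_R0.
move=> v z; rewrite -(H2 (upd v j s) (fun k => if Nat.eqb k j then Z0 else z k)).
congr g; apply: functional_extensionality => k; rewrite /upd.
by case: Nat.eqb; rewrite ?Rplus_0_r.
Qed.

Lemma unif_periodic_upd_dist g : unif_periodic g -> forall e, 0 < e -> exists dl, 0 < dl /\
  forall v j s s', Rabs (s - s') < dl -> Rabs (g (upd v j s) - g (upd v j s')) <= e.
Proof.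
move=> [H1 _ _] e He; have [dl [Hd H]] := H1 e He; exists dl; split=> // v j s s' Hs.
by apply: H => k; rewrite /upd; case: Nat.eqb; rewrite // Rminus_diag Rabs_R0.
Qed.

Lemma unif_cont_ex_RInt (I : R -> R) a b :
  (forall e, 0 < e -> exists dl, 0 < dl /\ forall s s', Rabs (s - s') < dl -> Rabs (I s - I s') <= e) ->
  ex_RInt I a b.
Proof.
move=> H; apply: ex_RInt_continuous => s _.
apply/continuity_pt_filterlim => e He.
have [dl [Hd H']] := H (e / 2) ltac:(lra); exists dl; split=> // x [_ Hx].
by apply: Rle_lt_trans (H' x s Hx) _; lra.
Qed.

(** The induction hypothesis serves twice: it compares the inner integrals, and it makes them
    uniformly continuous in the outer variable, hence integrable. *)
Lemma iter_int_dist n : forall g g' e, unif_periodic g -> unif_periodic g' ->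
  (forall v, Rabs (g v - g' v) <= e) -> Rabs (iter_int n g - iter_int n g') <= e.
Proof.
elim: n => [|n IH] g g' e Hg Hg' H /=; first exact: H.
have ex h : unif_periodic h -> ex_RInt (fun s => iter_int n (fun v => h (upd v n s))) 0 1.
  move=> Hh; apply: unif_cont_ex_RInt => eps He.
  have [dl [Hd Hdl]] := unif_periodic_upd_dist h Hh eps He; exists dl; split=> // s s' Hs.
  by apply: IH => [||v]; [apply: unif_periodic_upd | apply: unif_periodic_upd | apply: Hdl].
pose J h s := iter_int n (fun v => h (upd v n s)).
have -> : RInt (J g) 0 1 - RInt (J g') 0 1 = RInt (fun s => minus (J g s) (J g' s)) 0 1.
  by symmetry; apply: (RInt_minus (V := R_CompleteNormedModule) (J g) (J g')); apply: ex.
have := abs_RInt_le_const _ 0 1 e Rle_0_1 (ex_RInt_minus _ _ _ _ (ex g Hg) (ex g' Hg')).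
rewrite Rminus_0_r Rmult_1_l; apply=> t _.
by apply: IH => [||v]; [apply: unif_periodic_upd | apply: unif_periodic_upd | apply: H].
Qed.

Lemma iter_int_unif_cont n g : unif_periodic g -> forall e, 0 < e -> exists dl, 0 < dl /\
  forall s s', Rabs (s - s') < dl ->
    Rabs (iter_int n (fun v => g (upd v n s)) - iter_int n (fun v => g (upd v n s'))) <= e.
Proof.
move=> Hg e He; have [dl [Hd Hdl]] := unif_periodic_upd_dist g Hg e He; exists dl; split=> // s s' Hs.
by apply: iter_int_dist => [||v]; [apply: unif_periodic_upd | apply: unif_periodic_upd | apply: Hdl].
Qed.

Lemma riemann_sum_dist (I : R -> R) e dl (Q : nat) :
  (forall a b, ex_RInt I a b) -> (0 < Q)%N -> / INR Q < dl ->
  (forall s s', Rabs (s - s') < dl -> Rabs (I s - I s') <= e) ->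
  Rabs (/ INR Q * nsum Q (fun w => I (INR w / INR Q)) - RInt I 0 1) <= e.
Proof.
move=> ex HQ Hdl H.
have Q0 : 0 < INR Q by apply: lt_0_INR; lia.
have iQ : 0 < / INR Q by apply: Rinv_0_lt_compat.
suff B n : Rabs (/ INR Q * nsum n (fun w => I (INR w / INR Q)) - RInt I 0 (INR n / INR Q))
   <= INR n / INR Q * e.
  have E1 : INR Q / INR Q = 1 by field; lra.
  by have := B Q; rewrite E1 Rmult_1_l.
elim: n => [|n IH].
  by rewrite /= /Rdiv !Rmult_0_l Rmult_0_r RInt_point /zero /= Rminus_0_r Rabs_R0; lra.
set a := INR n / INR Q; set b := INR n.+1 / INR Q.
have ab : b = a + / INR Q by rewrite /b /a S_INR; field; lra.
rewrite -(RInt_Chasles I 0 a b) // [nsum _ _]/= /plus /= -/a.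
have -> : / INR Q * (nsum n (fun w => I (INR w / INR Q)) + I a) - (RInt I 0 a + RInt I a b) =
  (/ INR Q * nsum n (fun w => I (INR w / INR Q)) - RInt I 0 a) - (RInt I a b - / INR Q * I a) by ring.
have -> : RInt I a b - / INR Q * I a = RInt (fun s => I s - I a) a b.
  symmetry; have := RInt_minus (V := R_CompleteNormedModule) I (fun=> I a) a b (ex a b) (ex_RInt_const _ _ _).
  move=> ->; rewrite RInt_const ab /minus /plus /opp /scal /= /mult /=.
  by congr (_ + - _); ring.
have D : Rabs (RInt (fun s => I s - I a) a b) <= (b - a) * e.
  apply: abs_RInt_le_const; first lra.
    by apply: ex_RInt_minus => //; apply: ex_RInt_const.
  by move=> t Ht; apply: H; rewrite Rabs_right; lra.
apply: Rle_trans (Rabs_triang _ _) _; rewrite Rabs_Ropp.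
by have := IH; rewrite -/a -/b ab => IH'; rewrite ab in D; lra.
Qed.

(** * Weyl's criterion *)

(** If [u] and [w] are close modulo [1], uniform continuity gives [e]. Otherwise [1 - cos] is
    bounded below and [C] is chosen so that its term exceeds the trivial bound [2 * B]. *)
Lemma korovkin_modulus g : unif_periodic g -> forall e, 0 < e -> exists C, 0 <= C /\
  forall v j u w, Rabs (g (upd v j u) - g (upd v j w)) <= e + C * (1 - cos (2 * PI * (u - w))).
Proof.
move=> Hg e He; have [_ Hper [B HB]] := Hg.
have [dl0 [Hd0 Hdl]] := unif_periodic_upd_dist g Hg e He.
pose dl := Rmin dl0 (1 / 4).
have Hd : 0 < dl by apply: Rmin_glb_lt; lra.
have Hd4 : dl <= 1 / 4 by apply: Rmin_r.
have P := PI_RGT_0.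
have c1 : cos (2 * PI * dl) < 1.
  by rewrite -cos_0; apply: cos_decreasing_1; nra.
have B0 : 0 <= B by have := HB (fun=> 0); have := Rabs_pos (g (fun=> 0)); lra.
pose C := 2 * B / (1 - cos (2 * PI * dl)).
have HC : 0 <= C by apply: Rdiv_le_0_compat; lra.
exists C; split=> // v j u w.
have CB := COS_bound (2 * PI * (u - w)).
(* A nearest integer to [u - w], since [up x - 1] is the integer part unless [x] is an integer, when
   it is [x] itself. *)
pose z := Z.sub (up (u - w + 1 / 2)) (Zpos xH).
have [Hz1 Hz2] : - (1 / 2) <= u - w - IZR z /\ u - w - IZR z <= 1 / 2.
  by have := archimed (u - w + 1 / 2); rewrite /z minus_IZR; lra.
have Eu : g (upd v j u) = g (upd v j (u - IZR z)).
  rewrite -(Hper (upd v j (u - IZR z)) (fun k => if Nat.eqb k j then z else Z0)).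
  congr g; apply: functional_extensionality => k; rewrite /upd; case: Nat.eqb; ring.
set D := u - w - IZR z in Hz1 Hz2.
case: (Rlt_le_dec (Rabs D) dl) => HD.
  rewrite Eu; apply: Rle_trans (Hdl _ _ _ _ _) _.
    have -> : u - IZR z - w = D by rewrite /D; ring.
    by have := Rmin_l dl0 (1 / 4); rewrite -/dl; lra.
  by nra.
have cosD : cos (2 * PI * (u - w)) <= cos (2 * PI * dl).
  have -> : cos (2 * PI * (u - w)) = cos (2 * PI * Rabs D).
    have -> : 2 * PI * (u - w) = 2 * PI * D + 2 * PI * IZR z by rewrite /D; ring.
    rewrite cos_Zperiod /Rabs; case: Rcase_abs => // _.
    by rewrite -cos_neg; congr cos; ring.
  have HD2 : Rabs D <= 1 / 2 by apply: Rabs_le; lra.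
  by apply: cos_decr_1; nra.
have H2B : Rabs (g (upd v j u) - g (upd v j w)) <= 2 * B.
  have := HB (upd v j u); have := HB (upd v j w).
  by rewrite /Rabs; repeat case: Rcase_abs => ?; lra.
have : C * (1 - cos (2 * PI * dl)) = 2 * B by rewrite /C; field; lra.
by nra.
Qed.

Definition avg_lim (u : nat -> nat -> R) (l : R) : Prop :=
  is_lim_seq (fun n => / INR n * nsum n (u n)) l.

Lemma avg_lim_ext u v l : (forall n k, u n k = v n k) -> avg_lim u l -> avg_lim v l.
Proof. by move=> H; apply: is_lim_seq_ext => n; congr (_ * _); apply: nsum_ext. Qed.

Lemma avg_lim_scal c u l : avg_lim u l -> avg_lim (fun n k => c * u n k) (c * l).
Proof.
move=> H; apply: is_lim_seq_ext (is_lim_seq_mult' _ _ _ _ (is_lim_seq_const c) H) => n.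
by rewrite nsum_scal; ring.
Qed.

Lemma avg_lim_plus u v l l' :
  avg_lim u l -> avg_lim v l' -> avg_lim (fun n k => u n k + v n k) (l + l').
Proof.
move=> H H'; apply: is_lim_seq_ext (is_lim_seq_plus' _ _ _ _ H H') => n.
by rewrite nsum_plus; ring.
Qed.

Lemma avg_lim_nsum Q (u : nat -> nat -> nat -> R) (l : nat -> R) :
  (forall i, (i < Q)%N -> avg_lim (u i) (l i)) ->
  avg_lim (fun n k => nsum Q (fun i => u i n k)) (nsum Q l).
Proof.
elim: Q => [|Q IH] H /=.
  by apply: is_lim_seq_ext (is_lim_seq_const 0) => n; rewrite nsum_const; ring.
by apply: avg_lim_plus; [apply: IH => i Hi; apply: H; lia | apply: H].
Qed.

Lemma avg_lim_const c : avg_lim (fun _ _ => c) c.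
Proof.
apply: is_lim_seq_ext_loc (is_lim_seq_const c).
exists 1%N => n Hn; rewrite nsum_const; field.
by apply: not_0_INR; lia.
Qed.

Lemma avg_lim_approx u l :
  (forall e, 0 < e -> exists v a, [/\ avg_lim v a,
     forall n k, Rabs (u n k - v n k) <= e & Rabs (a - l) <= e]) ->
  avg_lim u l.
Proof.
move=> H; apply/is_lim_seq_spec => -[e He] /=.
have [v [a [Hv Huv Ha]]] := H (e / 4) ltac:(lra).
have He2 : 0 < e / 4 by lra.
have [N HN] := (is_lim_seq_spec _ _).2 Hv (mkposreal _ He2).
exists (maxn N 1) => n Hn.
have n0 : 0 < INR n by apply: lt_0_INR; lia.
have Q1 : Rabs (/ INR n * nsum n (v n) - a) < e / 4 by apply: HN; lia.
have Q2 : Rabs (/ INR n * nsum n (u n) - / INR n * nsum n (v n)) <= e / 4.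
  rewrite -Rmult_minus_distr_l -nsum_minus Rabs_mult Rabs_right; last first.
    by apply/Rle_ge/Rlt_le/Rinv_0_lt_compat.
  apply: (Rmult_le_reg_l (INR n)) => //; rewrite -Rmult_assoc Rinv_r ?Rmult_1_l; last lra.
  by apply: nsum_abs_le => k _; apply: Huv.
by move: Q1 Q2 Ha; rewrite /Rabs; repeat case: Rcase_abs => ?; lra.
Qed.

Section Weyl.
Variables (d : nat) (y : nat -> nat -> nat -> R).

Definition dot (h : nat -> Z) (v : nat -> R) : R := nsum d (fun i => IZR (h i) * v i).

Hypothesis weyl_sums : forall h th, (exists i, (i < d)%N /\ h i <> Z0) ->
  avg_lim (fun n k => cos (2 * PI * dot h (y n k) + th)) 0.

Definition trunc (j : nat) (v : nat -> R) : nat -> R :=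
  fun k => if (k < j)%N then v k else 0.

(** [e] is the Haar integral of the character of frequency [h]; only the first [d] entries
    matter. *)
Definition zero_freq (h : nat -> Z) (e : R) : Prop :=
  (forall i, (i < d)%N -> h i = Z0) /\ e = 1 \/
  (exists i, (i < d)%N /\ h i <> Z0) /\ e = 0.

Definition add_freq (h : nat -> Z) (j : nat) (c : Z) : nat -> Z :=
  fun i => Z.add (h i) (if j == i then c else Z0).

Lemma dot_add_freq h j c v : (j < d)%N -> dot (add_freq h j c) v = dot h v + IZR c * v j.
Proof.
move=> Hj; rewrite /dot -(@nsum_delta d j (IZR c * v j) Hj) -nsum_plus.
apply: nsum_ext => i _; rewrite /add_freq plus_IZR; case: eqP => [<-|_]; ring.
Qed.

(* The coordinates are absorbed one at a time: Fejer's kernel in coordinate [j]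
   replaces [g (trunc j.+1 y)] by a combination of products of functions of
   [trunc j y] and characters in [y j]. *)
Lemma weyl_induction j : (j <= d)%N ->
  forall g h th e, unif_periodic g -> (forall i, (i < j)%N -> h i = Z0) -> zero_freq h e ->
  avg_lim (fun n k => g (trunc j (y n k)) * cos (2 * PI * dot h (y n k) + th))
          (e * cos th * iter_int j g).
Proof.
elim: j => [|j IH] Hj g h th e Hg Hh He.
  have Et v : g (trunc 0 v) = g (fun=> 0).
    by congr g; apply: functional_extensionality => k; rewrite /trunc ltn0.
  rewrite [iter_int _ _]/= [e * cos th * _]Rmult_comm.
  apply: (avg_lim_ext (fun n k => g (fun=> 0) * cos (2 * PI * dot h (y n k) + th))).
    by move=> n k; rewrite Et.
  apply: avg_lim_scal; case: He => [[Z ->]|[nz ->]]; last by rewrite Rmult_0_l; apply: weyl_sums.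
  rewrite Rmult_1_l; apply: avg_lim_ext (avg_lim_const _) => n k.
  rewrite (_ : dot h (y n k) = 0); first by rewrite Rmult_0_r Rplus_0_l.
  rewrite /dot (nsum_ext _ _ (fun=> 0)); first by rewrite nsum_const; ring.
  by move=> i Hi; rewrite Z //; ring.
have e01 : Rabs (e * cos th) <= 1.
  rewrite Rabs_mult; have := cos_abs_le1 th; have := Rabs_pos (cos th).
  by case: He => [[_ ->]|[_ ->]]; rewrite ?Rabs_R1 ?Rabs_R0; lra.
pose gs s v := g (upd v j s).
pose I s := iter_int j (gs s).
have exI a b : ex_RInt I a b by apply: unif_cont_ex_RInt; apply: iter_int_unif_cont.
have Et v : g (trunc j.+1 v) = gs (v j) (trunc j v).
  congr g; apply: functional_extensionality => k; rewrite /trunc /upd.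
  case: (Nat.eqb_spec k j) => [->|ne]; first by rewrite ltnSn.
  by have -> : (k < j.+1)%N = (k < j)%N by lia.
apply: avg_lim_approx => eps Heps.
have [C [HC HK]] := korovkin_modulus g Hg (eps / 2) ltac:(lra).
have [M [HM0 HM]] := nat_above (4 * C / eps).
have M0 : 0 < INR M by apply: lt_0_INR; lia.
have [dl [Hdl HI]] := iter_int_unif_cont j g Hg eps Heps.
have [Q1 [HQ10 HQ1]] := nat_above (2 / dl).
(* [Q >= M] makes the discrete Fejer mean exact; [Q >= Q1] makes the Riemann sum of [I] accurate to
   [eps]. *)
pose Q := maxn M Q1.
have Q0 : 0 < INR Q by apply: lt_0_INR; rewrite /Q; lia.
have HMQ : (M <= Q)%N by rewrite /Q; lia.
have Qdl : / INR Q < dl.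
  have : 2 / dl <= INR Q by apply: Rle_trans HQ1 _; apply: le_INR; rewrite /Q; lia.
  move=> /(Rle_div_l _ _ _ Hdl) H; rewrite -[/ INR Q]Rmult_1_l; apply/Rlt_div_l => //; lra.
pose Ap (v : nat -> R) := / INR Q * nsum Q (fun w =>
   gs (INR w / INR Q) (trunc j v) * fejer M (2 * PI * (v j - INR w / INR Q))).
exists (fun n k => Ap (y n k) * cos (2 * PI * dot h (y n k) + th)),
  (/ INR Q * nsum Q (fun w => e * cos th * I (INR w / INR Q))).
split; last first.
- have -> : iter_int j.+1 g = RInt I 0 1 by [].
  rewrite nsum_scal -Rmult_assoc (Rmult_comm (/ INR Q)) Rmult_assoc -Rmult_minus_distr_l Rabs_mult.
  have R1 := riemann_sum_dist I eps dl Q exI ltac:(rewrite /Q; lia) Qdl HI.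
  have := Rabs_pos (/ INR Q * nsum Q (fun w => I (INR w / INR Q)) - RInt I 0 1).
  have := Rabs_pos (e * cos th); by nra.
- move=> n k; rewrite Et -Rmult_minus_distr_r Rabs_mult.
  have B1 := fejer_approx (fun s => gs s (trunc j (y n k))) (eps / 2) C M Q (y n k j) HM0 HMQ HC
    (fun w => HK _ _ _ _).
  have B2 := cos_abs_le1 (2 * PI * dot h (y n k) + th).
  have B3 : 2 * C / INR M <= eps / 2.
    apply/Rle_div_l => //; have : 4 * C <= INR M * eps by apply/Rle_div_l.
    by lra.
  set X := (X in Rabs X * _).
  have B4 : Rabs X <= eps by move: B1; rewrite -/X; lra.
  by have := Rabs_pos X; have := Rabs_pos (cos (2 * PI * dot h (y n k) + th)); nra.
- pose T w a b n k :=
    gs (INR w / INR Q) (trunc j (y n k)) *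
      cos (INR a * (2 * PI * (y n k j - INR w / INR Q)) - INR b * (2 * PI * (y n k j - INR w / INR Q))) *
      cos (2 * PI * dot h (y n k) + th).
  apply: (avg_lim_ext (fun n k => / INR Q * nsum Q (fun w => / INR M * nsum M (fun a => nsum M (fun b => T w a b n k))))).
    move=> n k; rewrite /Ap Rmult_assoc; congr (_ * _).
    rewrite [RHS]Rmult_comm -nsum_scal; apply: nsum_ext => w _.
    rewrite /fejer.
    set g0 := gs _ _; set c0 := cos _.
    have -> : c0 * (g0 * (/ INR M * nsum M (fun a => nsum M (fun b =>
      cos (INR a * (2 * PI * (y n k j - INR w / INR Q)) - INR b * (2 * PI * (y n k j - INR w / INR Q))))))) =
      / INR M * (c0 * g0 * nsum M (fun a => nsum M (fun b =>
      cos (INR a * (2 * PI * (y n k j - INR w / INR Q)) - INR b * (2 * PI * (y n k j - INR w / INR Q)))))) by ring.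
    congr (_ * _); rewrite -nsum_scal; apply: nsum_ext => a _.
    by rewrite -nsum_scal; apply: nsum_ext => b _; rewrite /T -/g0 -/c0; ring.
  apply: avg_lim_scal; apply: avg_lim_nsum => w Hw.
  have -> : e * cos th * I (INR w / INR Q) =
    / INR M * nsum M (fun a => nsum M (fun b => if a == b then e * cos th * I (INR w / INR Q) else 0)).
    rewrite (nsum_ext M _ (fun=> e * cos th * I (INR w / INR Q))).
      by rewrite nsum_const; field; lra.
    by move=> a Ha; rewrite nsum_delta.
  apply: avg_lim_scal; apply: avg_lim_nsum => a Ha; apply: avg_lim_nsum => b Hb.
  pose c := Z.sub (Z.of_nat a) (Z.of_nat b).
  have cE : IZR c = INR a - INR b by rewrite minus_IZR -!INR_IZR_INZ.
  pose ph := 2 * PI * IZR c * (INR w / INR Q).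
  pose U s := fun n k => gs (INR w / INR Q) (trunc j (y n k)) *
    cos (2 * PI * dot (add_freq h j (Z.mul s c)) (y n k) + (th - IZR s * ph)).
  apply: (avg_lim_ext (fun n k => / 2 * (U (Zpos xH) n k + U (Zneg xH) n k))).
    move=> n k; rewrite /U /T !dot_add_freq // !mult_IZR.
    set A := 2 * PI * dot h (y n k) + th; set x := 2 * PI * (y n k j - INR w / INR Q).
    have -> : 2 * PI * (dot h (y n k) + 1 * IZR c * y n k j) + (th - 1 * ph) = A + IZR c * x.
      by rewrite /A /x /ph; ring.
    have -> : 2 * PI * (dot h (y n k) + -1 * IZR c * y n k j) + (th - -1 * ph) = A - IZR c * x.
      by rewrite /A /x /ph; ring.
    have -> : INR a * x - INR b * x = IZR c * x by rewrite cE; ring.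
    by rewrite cos_plus cos_minus; field.
  (* For [a = b] the frequency [h] is unchanged. Otherwise its [j]-th entry, zero so far, becomes
     [s * c <> 0], and the limit is [0]. *)
  have LU s : s <> Z0 -> avg_lim (U s) (if a == b then e * cos th * I (INR w / INR Q) else 0).
    move=> Hs.
    have Hlow i : (i < j)%N -> add_freq h j (Z.mul s c) i = Z0.
      by move=> Hi; rewrite /add_freq Hh; [case: eqP => // E; lia | lia].
    case: eqP => [ab|ab].
      have c0 : c = Z0 by rewrite /c ab; lia.
      have ph0 : th - IZR s * ph = th by rewrite /ph c0; ring.
      rewrite -{1}ph0; apply: IH => //; [lia | exact: unif_periodic_upd | ].
      have E i : add_freq h j (Z.mul s c) i = h i by rewrite /add_freq c0; case: eqP => _; lia.
      case: He => [[Z ->]|[[i [Hi nz]] ->]]; first by left; split=> // i Hi; rewrite E Z.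
      by right; split=> //; exists i; rewrite E.
    have := IH ltac:(lia) (gs (INR w / INR Q)) (add_freq h j (Z.mul s c)) (th - IZR s * ph) 0.
    rewrite !Rmult_0_l; apply=> //; first exact: unif_periodic_upd.
    right; split=> //; exists j; split=> //.
    by rewrite /add_freq Hh // eqxx /c; nia.
  set l := (X in avg_lim _ X).
  have -> : l = / 2 * (l + l) by field.
  by apply: avg_lim_scal; apply: avg_lim_plus; apply: LU.
Qed.
End Weyl.

(** * Rationally non-degenerate families *)

(** Integer translation moves the first point into the unit cube, where a Lebesgue number exists.
    The second point is moved by the same integers and may leave the cube, hence the balls of radius
    [2 * r]. *)
Lemma torus_unif_periodic (d : nat) (f : ('I_d -> R) -> R) :
  torus_continuous f -> unif_periodic (fun v => f (fun i : 'I_d => v i)).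
Proof.
move=> [Hc Hp].
have frac x : 0 <= x + IZR (Z.sub (Zpos xH) (up x)) <= 1.
  by have := archimed x; rewrite minus_IZR; lra.
split.
- move=> e He.
  have [|dl [Hd HL]] := @cube_lebesgue d (fun p r => forall x, (forall j, Rabs (x j - p j) < 2 * r) ->
     Rabs (f x - f p) < e / 2).
    move=> p _; have [dl [Hd H]] := Hc p (e / 2) ltac:(lra).
    by exists (dl / 2); split; [lra | move=> x Hx; apply: H => j; have := Hx j; lra].
  exists dl; split=> // u v Huv.
  pose z (i : 'I_d) := Z.sub (Zpos xH) (up (u i)).
  rewrite -(Hp (fun i => u i) z) -(Hp (fun i => v i) z).
  have [|p [r [_ HV Hdr Hpr]]] := HL (fun i : 'I_d => u i + IZR (z i)).
    by move=> i; apply: frac.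
  have r0 : 0 < r by lra.
  have V1 : Rabs (f (fun i : 'I_d => u i + IZR (z i)) - f p) < e / 2.
    by apply: HV => j; have := Hpr j; lra.
  have V2 : Rabs (f (fun i : 'I_d => v i + IZR (z i)) - f p) < e / 2.
    apply: HV => j.
    have -> : v j + IZR (z j) - p j = - (u j - v j) + (u j + IZR (z j) - p j) by ring.
    apply: Rle_lt_trans (Rabs_triang _ _) _; rewrite Rabs_Ropp.
    by have := Huv j; have := Hpr j; lra.
  by move: V1 V2; rewrite /Rabs; repeat case: Rcase_abs => ?; lra.
- move=> v z; exact: (Hp (fun i : 'I_d => v i) (fun i : 'I_d => z i)).
- have [|dl [Hd HL]] := @cube_lebesgue d (fun p r => forall x, (forall j, Rabs (x j - p j) < r) ->
     Rabs (f x) <= / r).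
    move=> p _; have [dl [Hd H]] := Hc p 1 Rlt_0_1.
    have F0 : 0 < Rabs (f p) + 1 by have := Rabs_pos (f p); lra.
    have m0 : 0 < Rmin dl (/ (Rabs (f p) + 1)) by apply: Rmin_glb_lt => //; apply: Rinv_0_lt_compat.
    exists (Rmin dl (/ (Rabs (f p) + 1))); split=> // x Hx.
    apply: Rle_trans (_ : Rabs (f p) + 1 <= _); last first.
      by rewrite -[X in X <= _]Rinv_inv; apply: Rinv_le_contravar => //; apply: Rmin_r.
    have := H x (fun j => Rlt_le_trans _ _ _ (Hx j) (Rmin_l _ _)).
    by rewrite /Rabs; repeat case: Rcase_abs => ?; lra.
  exists (/ dl) => v.
  pose z (i : 'I_d) := Z.sub (Zpos xH) (up (v i)).
  rewrite -(Hp (fun i => v i) z).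
  have [|p [r [_ HV Hdr Hpr]]] := HL (fun i : 'I_d => v i + IZR (z i)).
    by move=> i; apply: frac.
  by apply: Rle_trans (HV _ Hpr) _; apply: Rinv_le_contravar.
Qed.

Lemma locexp_ex_derive_n (m : nat) (F : ('I_m -> R) -> R -> R) x t n :
  locexp F x t -> locally t (fun u => forall k, (k <= n)%N -> ex_derive_n (F x) k u).
Proof.
move=> H; elim: n => [|n IH].
  by apply: filter_forall => u [|k].
have [_ [r [Hr HD]]] := locexp_derive _ _ _ (locexp_Derive_n _ _ _ n H).
have L : locally t (fun u => ex_derive_n (F x) n.+1 u).
  exists (mkposreal r Hr) => u Hu; apply: (HD x u) => // j.
  by rewrite Rminus_diag Rabs_R0.
apply: filter_imp (filter_and _ _ IH L) => u [H1 H2] k Hk.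
case: (eqVneq k n.+1) => [->|ne] //; apply: H1; lia.
Qed.

Lemma Derive_n_rsum (m : nat) (I : finType) (c : I -> R)
  (G : I -> ('I_m -> R) -> R -> R) x t n :
  (forall i, locexp (G i) x t) ->
  Derive_n (fun u => rsum (fun i => c i * G i x u)) n t =
  rsum (fun i => c i * Derive_n (G i x) n t).
Proof.
move=> H.
have [_] : locexp (fun x u => \sum_(i <- index_enum I) (c i * G i x u))%R x t /\
  Derive_n (fun u => (\sum_(i <- index_enum I) (c i * G i x u))%R) n t =
  (\sum_(i <- index_enum I) (c i * Derive_n (G i x) n t))%R; last by [].
elim: (index_enum I) => [|i r [IH1 IH2]].
  split; first by apply: locexp_ext (locexp_0 x t) => y u; rewrite big_nil.
  rewrite big_nil (Derive_n_ext _ (fun=> 0)); last by move=> u; rewrite big_nil.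
  by case: n => [//|n]; rewrite Derive_n_const.
have Hi := locexp_scal (c i) _ _ _ (H i).
split.
  by apply: locexp_ext (locexp_plus _ _ _ _ Hi IH1) => y u; rewrite big_cons.
rewrite big_cons -IH2.
rewrite (Derive_n_ext _ (fun u => c i * G i x u + (\sum_(i <- r) (c i * G i x u))%R)); last first.
  by move=> u; rewrite big_cons.
rewrite Derive_n_plus.
- by rewrite Derive_n_scal_l.
- by apply: filter_imp (locexp_ex_derive_n _ _ _ _ n Hi) => u Hu k Hk; apply: Hu; lia.
- by apply: filter_imp (locexp_ex_derive_n _ _ _ _ n IH1) => u Hu k Hk; apply: Hu; lia.
Qed.

(** At the endpoints vanishing on [[0, 1]] is only one-sided information, while [Derive] is
    two-sided. Analyticity closes the gap: a zero that is not isolated forces vanishing on a full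
    neighbourhood. *)
Lemma Derive_n_vanish_succ (m : nat) (F : ('I_m -> R) -> R -> R) x j :
  (forall s, 0 <= s <= 1 -> locexp F x s) ->
  (forall s, 0 <= s <= 1 -> Derive_n (F x) j s = 0) ->
  forall s, 0 <= s <= 1 -> Derive_n (F x) j.+1 s = 0.
Proof.
move=> HF HZ s Hs.
case: (locexp_zero_dichotomy _ _ _ (locexp_Derive_n _ _ _ j (HF s Hs))) => [[r [Hr H]]|[r [Hr H]]].
  rewrite /= (Derive_ext_loc _ (fun=> 0)); first exact: Derive_const.
  by exists (mkposreal r Hr) => u Hu; apply: H.
pose q := Rmin (r / 2) (1 / 2).
have q0 : 0 < q by apply: Rmin_glb_lt; lra.
have q1 : q <= r / 2 by apply: Rmin_l.
have q2 : q <= 1 / 2 by apply: Rmin_r.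
case: (Rle_lt_dec s (1 / 2)) => Hs2.
  by case: (H (s + q)); [lra | apply: Rabs_def1; lra | apply: HZ; lra].
by case: (H (s - q)); [lra | apply: Rabs_def1; lra | apply: HZ; lra].
Qed.

(** The order is a supremum of indices, so it only yields some index [j >= q]; this descends from
    [j] to [q] itself. *)
Lemma rnd_index_le (m d : nat) (phi : ('I_m -> R) -> R -> ('I_d -> R)) x i j :
  family_analytic phi -> in_cube x -> (1 <= i)%N -> (i <= j)%N ->
  rnd_index (phi x) j -> rnd_index (phi x) i.
Proof.
move=> Han Hx Hi Hij [_ Hj]; split=> // h Hh; have [t [Ht ne]] := Hj h Hh.
apply: NNPP => no; apply: ne.
pose F x t := rsum (fun i : 'I_d => IZR (h i) * phi x t i).
have Hphi l s : 0 <= s <= 1 -> locexp (fun x t => phi x t l) x s.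
  by move=> Hs; apply: analytic_at_locexp; apply: Han.
have HF s : 0 <= s <= 1 -> locexp F x s.
  by move=> Hs; apply: locexp_rsum => l; apply: locexp_scal; apply: Hphi.
have E k s : 0 <= s <= 1 -> hdot_deriv (phi x) h k s = Derive_n (F x) k s.
  by move=> Hs; rewrite (Derive_n_rsum _ _ _ (fun l x t => phi x t l)) // => l; apply: Hphi.
rewrite E //.
suff H k : forall s, 0 <= s <= 1 -> Derive_n (F x) (i + k)%N s = 0.
  by have := H (j - i)%N t Ht; rewrite subnKC.
elim: k => [|k IH].
  move=> s Hs; rewrite addn0 -E //; apply: NNPP => ne; apply: no; by exists s.
by rewrite addnS; apply: Derive_n_vanish_succ.
Qed.

Lemma curve_rnd_order_index (d : nat) (g : R -> 'I_d -> R) k q :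
  curve_rnd_order g k -> enat_le (Some q) k -> (1 <= q)%N ->
  exists j, (q <= j)%N /\ rnd_index g j.
Proof.
move=> [_ lub] Hq Hq1; apply: NNPP => no.
have := lub (Some q.-1); case: k Hq {lub} => [k|] /= Hq H.
  suff : (k <= q.-1)%N by lia.
  apply: H => j Hj; case: (leqP q j) => Hqj; last by lia.
  by case: no; exists j.
apply: H => j Hj; case: (leqP q j) => Hqj; last by lia.
by case: no; exists j.
Qed.

Lemma weyl_sums_vanish (m d : nat) (phi : ('I_m -> R) -> R -> ('I_d -> R))
  (q : nat) (rho : nat -> R) (xs : nat -> ('I_m -> R)) (h : 'I_d -> Z) th :
  family_analytic phi -> (0 < q)%N ->
  (forall x, in_cube x -> rnd_index (phi x) q) ->
  is_lim_seq rho p_infty -> is_lim_seq (fun n => rho n / INR n ^ q) 0 ->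
  (forall n, in_cube (xs n)) -> (exists i, h i <> Z0) ->
  avg_lim (fun n k => cos (2 * PI *
    rsum (fun i => IZR (h i) * (rho n * phi (xs n) (INR k.+1 / INR n) i)) + th)) 0.
Proof.
move=> Han Hq Hrnd Hrho Hsmall Hxs Hh.
have P2 : 2 * PI <> 0 by have := PI_RGT_0; lra.
pose F0 x t := rsum (fun i : 'I_d => IZR (h i) * phi x t i).
pose F x t := 2 * PI * F0 x t.
have Hphi l x s : in_cube x -> 0 <= s <= 1 -> locexp (fun x t => phi x t l) x s.
  by move=> Hx Hs; apply: analytic_at_locexp; apply: Han.
have HF x s : in_cube x -> 0 <= s <= 1 -> locexp F x s.
  move=> Hx Hs; apply: locexp_scal; apply: locexp_rsum => l; apply: locexp_scal; exact: Hphi.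
have Hnd x : in_cube x -> exists t, 0 <= t <= 1 /\ Derive_n (F x) q t <> 0.
  move=> Hx; have [_ H] := Hrnd x Hx; have [t [Ht ne]] := H h Hh; exists t; split=> //.
  rewrite /F Derive_n_scal_l (Derive_n_rsum _ _ _ (fun l x t => phi x t l)); last by move=> l; apply: Hphi.
  exact: Rmult_integral_contrapositive_currified.
apply: (avg_lim_ext (fun n k => cos (rho n * F (xs n) (INR k.+1 / INR n) + th))).
  move=> n k; congr (cos (_ + _)); rewrite /F /F0 -Rmult_assoc (Rmult_comm (rho n)) Rmult_assoc.
  by congr (_ * _); rewrite -rsum_scal; apply: rsum_ext => i; ring.
apply/is_lim_seq_spec => -[e He] /=.
have [N HN] := cos_sum_uniform m F q rho Hq HF Hrho Hsmall Hnd (e / 4) ltac:(lra).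
have [N2 [HN20 HN2]] := nat_above (4 / e).
exists (maxn N N2) => n Hn.
have n0 : 0 < INR n by apply: lt_0_INR; lia.
have n1 : 4 <= INR n * e.
  apply/(Rle_div_l _ _ _ He); apply: Rle_trans HN2 _; apply: le_INR; lia.
have B1 := HN n (xs n) th ltac:(lia) (Hxs n).
(* The measures sample at [1/n, ..., n/n], the cosine bound at [0, ..., (n-1)/n]; the shift costs at
   most [2]. *)
have B2 : Rabs (nsum n (fun k => cos (rho n * F (xs n) (INR k.+1 / INR n) + th))
    - nsum n (fun k => cos (rho n * F (xs n) (INR k / INR n) + th))) <= 2 * 1.
  exact: (nsum_shift_dist n 1 (fun k => cos (rho n * F (xs n) (INR k / INR n) + th))
    (fun k => cos_abs_le1 _)).
rewrite Rminus_0_r Rabs_mult Rabs_right; last by apply/Rle_ge/Rlt_le/Rinv_0_lt_compat.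
apply: (Rmult_lt_reg_l (INR n)) => //; rewrite -Rmult_assoc Rinv_r ?Rmult_1_l; last lra.
have B3 : Rabs (nsum n (fun k => cos (rho n * F (xs n) (INR k.+1 / INR n) + th))) <= e / 4 * INR n + 2.
  by move: B1 B2; rewrite /Rabs; repeat case: Rcase_abs => ?; lra.
by apply: Rle_lt_trans B3 _; lra.
Qed.

Lemma rsum_nat_shift n (u : nat -> R) : rsum_nat 1 n.+1 u = nsum n (fun k => u k.+1).
Proof.
rewrite /rsum_nat; elim: n => [|n IH]; first by rewrite big_geq.
by rewrite big_nat_recr //= IH.
Qed.

Theorem theorem1p2 (m d : nat) (phi : ('I_m -> R) -> R -> ('I_d -> R))
  (kappa : enat) (rho : nat -> R) (xs : nat -> ('I_m -> R)) :
  family_analytic phi ->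
  family_rnd_order phi kappa ->
  enat_le (Some 2%nat) kappa ->
  is_lim_seq rho p_infty ->
  (forall k : nat, kappa = Some k ->
     is_lim_seq (fun n => rho n / (INR n ^ k)) 0) ->
  (kappa = None ->
     exists l : nat, is_lim_seq (fun n => rho n / (INR n ^ l)) 0) ->
  (forall n, in_cube (xs n)) ->
  forall f : ('I_d -> R) -> R, torus_continuous f ->
    is_lim_seq
      (fun n : nat => / INR n *
         rsum_nat 1 n.+1
           (fun k => f (fun i => rho n * phi (xs n) (INR k / INR n) i)))
      (haar_int f).
Proof.
move=> Han [ord [Hord [Hle _]]] H2 Hrho Hfin Hinf Hxs f Hf.
have [q [Hq0 Hsmall Hq]] : exists q, [/\ (0 < q)%N,
    is_lim_seq (fun n => rho n / INR n ^ q) 0 &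
    forall x, in_cube x -> enat_le (Some q) (ord x)].
  case: kappa H2 Hle Hfin Hinf => [k|] H2 Hle Hfin Hinf.
    by exists k; split; [rewrite /= in H2; lia | apply: Hfin | ].
  (* Raising the exponent by one makes it positive, as an index must be, and keeps the limit [0]. *)
  have [l Hl] := Hinf erefl; exists l.+1; split=> //; last first.
    by move=> x Hx; have := Hle x Hx; case: (ord x).
  have L : is_lim_seq (fun n => / INR n) 0.
    have := is_lim_seq_inv _ _ is_lim_seq_INR; apply; by [].
  have := is_lim_seq_mult' _ _ _ _ Hl L; rewrite Rmult_0_l.
  apply: is_lim_seq_ext => n.
  by rewrite -tech_pow_Rmult /Rdiv Rinv_mult; ring.
have Hrnd x : in_cube x -> rnd_index (phi x) q.
  move=> Hx; have [j [Hj Hr]] := curve_rnd_order_index _ _ _ _ (Hord x Hx) (Hq x Hx) Hq0.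
  exact: rnd_index_le Hj Hr.
pose y n k (i : nat) :=
  if insub i is Some l then rho n * phi (xs n) (INR k.+1 / INR n) l else 0.
have yE n k (l : 'I_d) : y n k l = rho n * phi (xs n) (INR k.+1 / INR n) l.
  by rewrite /y valK.
pose g (v : nat -> R) := f (fun i : 'I_d => v i).
have Hws h th : (exists i, (i < d)%N /\ h i <> Z0) ->
    avg_lim (fun n k => cos (2 * PI * dot d h (y n k) + th)) 0.
  move=> [i [Hi nz]].
  have W := weyl_sums_vanish m d phi q rho xs (fun l => h l) th Han Hq0 Hrnd Hrho Hsmall Hxs
    (ex_intro _ (Ordinal Hi) nz).
  apply: avg_lim_ext W => n k; congr (cos (_ * _ + _)).
  by rewrite /dot -rsum_ord; apply: rsum_ext => l; rewrite yE.
(* With frequency and phase zero the character is [1], and with [j = d] every coordinate of [f] has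
   been absorbed. *)
have := weyl_induction d y Hws d (leqnn d) g (fun=> Z0) 0 1 (torus_unif_periodic d f Hf)
  (fun _ _ => erefl) (or_introl (conj (fun _ _ => erefl) erefl)).
rewrite cos_0 !Rmult_1_l => L; rewrite /haar_int -/g.
apply: is_lim_seq_ext L => n; rewrite rsum_nat_shift; congr (_ * _).
apply: nsum_ext => k _.
have -> : dot d (fun=> Z0) (y n k) = 0.
  by rewrite /dot (nsum_ext _ _ (fun=> 0)); [rewrite nsum_const; ring | move=> i _; ring].
rewrite Rmult_0_r Rplus_0_r cos_0 Rmult_1_r; congr f.
by apply: functional_extensionality => l; rewrite /trunc ltn_ord yE.
Qed.
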